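(* Let $\mathbf{k}$ be an algebraically closed field and let $\mathcal{H}\subset\mathbb{N}$ be a symmetric numerical semigroup of genus $g$ with smallest positive element $n_1$, such that $3<n_1<g$ and $\mathcal{H}\neq\langle 4,5\rangle$. Assume that the characteristic of $\mathbf{k}$ is zero or a prime not dividing any difference $n-m$ with $m<n\le 2g-2$ elements of $\mathcal{H}$. Let $\overline{\mathscr{M}}_{\mathcal{H}}=(\mathcal{X}_{\mathcal{H}}\setminus\{\mathfrak{o}\})/\mathbb{G}_m$ be the compactified moduli space of pointed complete integral Gorenstein curves with Weierstrass semigroup $\mathcal{H}$, and let $\mathcal{Q}_{\mathcal{H}}$ be the quadratic quasi-cone approximating $\mathcal{X}_{\mathcal{H}}$ at its vertex $\mathfrak{o}$ (both described in the context). Then $$\dim\overline{\mathscr{M}}_{\mathcal{H}}\le\dim\mathbb{P}(\mathcal{Q}_{\mathcal{H}}),\qquad\text{i.e.}\qquad \dim\overline{\mathscr{M}}_{\mathcal{H}}<\dim\mathcal{Q}_{\mathcal{H}}.$$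
   Context: Semigroup notation. $0=n_0<n_1<n_2<\dots$ are the elements (nongaps) of $\mathcal{H}$, $g=\#(\mathbb{N}\setminus\mathcal{H})$ is its genus, and $1=\ell_1<\dots<\ell_g$ are its gaps. $\mathcal{H}$ is symmetric if $\ell_g=2g-1$ (equivalently, an integer $\ell$ is a gap iff $2g-1-\ell$ is a nongap); then $n_{g-1}=2g-2$. Quadratic forms. For each nongap $s\le 4g-4$ list all partitions $s=a_{si}+b_{si}$, $a_{si}\le b_{si}$ ($i=0,\dots,\nu_s$), of $s$ into two nongaps $\le 2g-2$; put $a_s:=a_{s0}$, $b_s:=b_{s0}$. (Each such $s$ has at least one partition.) If $s=n_i+2g-2$ with $0\le i\le g-3$, then $\nu_s\ge1$ and the listing is chosen so that $(a_{s1},b_{s1})=(n_i,2g-2)$. In $\mathbf{k}[X_{n_0},\dots,X_{n_{g-1}}]$, where $X_n$ has weight $n$, put, for each $s$ and $1\le i\le\nu_s$, $$F_{si}^{(0)}=X_{a_{si}}X_{b_{si}}-X_{a_s}X_{b_s},\qquad F_{si}=F_{si}^{(0)}-\sum_{n\in\mathcal{H},\,n<s}c_{sin}X_{a_n}X_{b_n},$$ with $c_{sin}$ viewed as unknowns of weight $s-n$. There are $\frac12(g-2)(g-3)$ forms $F_{si}$. The polynomials $\varrho$. For each of the $\frac12(g-2)(g-5)$ double indices $s'i'$ different from $(n_i+2g-2,1)$, $i=0,\dots,g-3$, there is a syzygy $X_{2g-2}F^{(0)}_{s'i'}+\sum\varepsilon^{(s'i')}_{nsi}X_nF^{(0)}_{si}=0$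 with $\varepsilon^{(s'i')}_{nsi}\in\{0,\pm1\}$, summed over nongaps $n<2g-2$ and double indices $si$ with $n+s=2g-2+s'$. Fix such syzygies and decompositions $$X_{2g-2}F_{s'i'}+\sum\varepsilon^{(s'i')}_{nsi}X_nF_{si}=\sum\eta^{(s'i')}_{nsi}X_nF_{si}+R_{s'i'},$$ the right-hand sum being over nongaps $n\le 2g-2$ and $si$ with $n+s<s'+2g-2$, where $R_{s'i'}=\sum_m\varrho_{s'i'm}Z_{s'i'm}$, the sum is over nongaps $m<s'+2g-2$, $Z_{s'i'm}$ is a monic cubic monomial of weight $m$ in the $X_n$, and $\varrho_{s'i'm}$ (resp. $\eta^{(s'i')}_{nsi}$) is a quasi-homogeneous polynomial of weight $s'+2g-2-m$ (resp. $s'+2g-2-n-s$) in the $c_{sin}$. Such decompositions exist. Normalization. By coordinate changes $X_n\mapsto X_n+\sum_{m<n}d_{nm}X_m$ ($m,n$ nongaps $\le 2g-2$), $\frac12g(g-1)$ of the $c_{sin}$ are normalized to be zero. Precisely: for each $w\geq 1$, fix a set $N_w$ of coefficients $c_{sin}$ of weight $s-n=w$, of cardinality the number of nongaps $m$ with $m+w$ a nongap $\le 2g-2$, such that the linear map $(d_n)\mapsto\big(d_{a_{si}}+d_{b_{si}}-d_{a_s}-d_{b_s}\big)_{c_{sin}\in N_w}$ is bijective, where $(d_n)$ is indexed by the nongaps $n\le 2g-2$ with $n-w\in\mathcal{H}$ and $d_n:=0$ for all other $n$ (such sets exist under the characteristic assumption). All coefficients in the sets $N_w$ are set equal to zero.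 Write the remaining coefficients as $c_0,\dots,c_\nu$ with weights $w_0,\dots,w_\nu$, and the polynomials $\varrho_{s'i'm}$ as $\varrho_1,\dots,\varrho_\mu$, with homogeneous components (for the ordinary degree in the $c_i$) $\varrho_j=\varrho_j^{(1)}+\varrho_j^{(2)}+\cdots$. $\mathbb{G}_m=\mathbf{k}^*$ acts by $(c_i)\mapsto(c^{w_i}c_i)$. The orbits on the zero locus of $\varrho_1,\dots,\varrho_\mu$ correspond bijectively to the isomorphism classes of pointed complete integral Gorenstein curves $(\mathcal{C},P)$, $P$ a smooth point with Weierstrass semigroup $\mathcal{H}$, the origin corresponding to the monomial curve. The spaces. $\mathcal{T}_{\mathcal{H}}=\{\varrho_j^{(1)}=0,\ j=1,\dots,\mu\}\subseteq\mathbf{k}^{\nu+1}$. After a permutation, the linear equations $\varrho_j^{(1)}=0$ are solved for $c_{r+1},\dots,c_\nu$ with $r$ minimal, so $\mathcal{T}_{\mathcal{H}}$ is identified with the weighted vector space of vectors $(c_0,\dots,c_r)$. By quasi-homogeneity the variables $c_{r+1},\dots,c_\nu$ can likewise be eliminated, using $\nu-r$ of the polynomial equations $\varrho_j=0$; substituting into the others yields $\mu-(\nu-r)$ quasi-homogeneous polynomials $h_j(c_0,\dots,c_r)$ with zero linear components $h_j^{(1)}=0$. Put $$\mathcal{X}_{\mathcal{H}}=\{h_j=0\ \forall j\}\subseteq\mathbf{k}^{r+1},\qquad \mathcal{Q}_{\mathcal{H}}=\{h_j^{(2)}=0\ \forall j\}\subseteq\mathbf{k}^{r+1},$$ where $h_j^{(2)}$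 is the homogeneous component of degree 2 of $h_j$. $\mathfrak{o}$ is the origin, and $\mathbb{P}(Y)=(Y\setminus\{\mathfrak{o}\})/\mathbb{G}_m$ for a $\mathbb{G}_m$-stable closed subset $Y\subseteq\mathbf{k}^{r+1}$; it is a closed subset of the weighted projective space with weights $w_0,\dots,w_r$. $\overline{\mathscr{M}}_{\mathcal{H}}$ is identified with $\mathbb{P}(\mathcal{X}_{\mathcal{H}})$. The dimension of the empty set is $-1$. *)

(* Defs.v *)
From HB Require Import structures.
From mathcomp Require Import all_boot all_order all_algebra.
From mathcomp Require Export mpoly.

Set Implicit Arguments.
Unset Strict Implicit.
Unset Printing Implicit Defensive.

Import GRing.Theory.

Definition numerical_semigroup (H : pred nat) : Prop :=
  [/\ H 0, (forall m n, H m -> H n -> H (m + n))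
    & exists N, forall n, N <= n -> H n].

Definition gap_sequence (H : pred nat) (ell : seq nat) : Prop :=
  sorted ltn ell /\ (forall n, (n \in ell) = ~~ H n).

Definition multiplicity (H : pred nat) (n1 : nat) : Prop :=
  [/\ 0 < n1, H n1 & forall n, 0 < n -> H n -> n1 <= n].

(* The nongaps < b, in increasing order. *)
Definition nongaps (H : pred nat) (b : nat) : seq nat :=
  [seq n <- iota 0 b | H n].

(* n_0, ..., n_{g-1} when H is symmetric of genus g; the variables X_n are
   indexed by this list. *)
Definition ngs (H : pred nat) (g : nat) : seq nat := nongaps H (2 * g - 2).+1.

(* A double index si is the pair (s, i); the index of c_{sin}, and also that
   of rho_{s'i'm}, is a pair ((s, i), n). *)
Definition didx := (nat * nat)%type.
Definition cidx := (didx * nat)%type.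

Definition cwt (t : cidx) : nat := t.1.1 - t.2.

Definition partitions (H : pred nat) (g s : nat) : seq (nat * nat) :=
  [seq ab <- [seq (a, b) | a <- ngs H g, b <- ngs H g]
     | (ab.1 <= ab.2) && (ab.1 + ab.2 == s)].

(* L s lists the partitions (a_{si}, b_{si}) of s, i = 0, ..., nu_s, so that
   nu_s = (size (L s)).-1. *)
Definition partition_listing (H : pred nat) (g : nat)
    (L : nat -> seq (nat * nat)) : Prop :=
  (forall s, H s -> s <= 4 * g - 4 -> perm_eq (L s) (partitions H g s)) /\
  (forall i, i < g - 2 ->
     let n := nth 0 (ngs H g) i in
     1 < size (L (n + (2 * g - 2))) /\
     nth (0, 0) (L (n + (2 * g - 2))) 1 = (n, 2 * g - 2)).

Section Indices.
Variables (H : pred nat) (g : nat) (L : nat -> seq (nat * nat)).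

Definition pa (q : didx) : nat := (nth (0, 0) (L q.1) q.2).1.
Definition pb (q : didx) : nat := (nth (0, 0) (L q.1) q.2).2.

Definition dindices : seq didx :=
  [seq (s, i) | s <- nongaps H (4 * g - 4).+1, i <- iota 1 (size (L s)).-1].

Definition special_dindices : seq didx :=
  [seq (nth 0 (ngs H g) i + (2 * g - 2), 1) | i <- iota 0 (g - 2)].

(* The double indices s'i'. *)
Definition syz_dindices : seq didx :=
  [seq q <- dindices | q \notin special_dindices].

Definition coefs : seq cidx := [seq (q, n) | q <- dindices, n <- nongaps H q.1].

Definition rho_indices : seq cidx :=
  [seq (q, m) | q <- syz_dindices, m <- nongaps H (q.1 + (2 * g - 2))].

End Indices.

Local Open Scope ring_scope.

(* The polynomial rings below have variables indexed by a duplicate-free list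
   l; a family v over the positions of l is read as a family over T, extended
   by 0 outside l. *)
Definition extend0 (T : eqType) (V : nmodType) (l : seq T)
    (v : 'I_(size l) -> V) (t : T) : V :=
  if insub (index t l) is Some i then v i else 0.

Definition mvar (R : comNzRingType) (T : eqType) (l : seq T) (t : T) :
    {mpoly R[size l]} := extend0 (fun i : 'I_(size l) => 'X_i) t.

(* Weighted degree of monomials, the variable at t having weight wt t; a
   polynomial p is quasi-homogeneous of weight d when
   p \is d.-homog for (wdeg wt l). *)
Definition wdeg (T : eqType) (wt : T -> nat) (l : seq T)
    (m : 'X_{1..size l}) : nat :=
  (\sum_(i < size l) wt (tnth (in_tuple l) i) * m i)%N.

Section WdegMeasure.
Variables (T : eqType) (wt : T -> nat) (l : seq T).

Fact wdeg0 : wdeg wt (l := l) 0%MM = 0%N.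
Proof. by rewrite /wdeg big1 // => i _; rewrite mnm0E muln0. Qed.

Fact wdegD : {morph @wdeg T wt l : m1 m2 / (m1 + m2)%MM >-> (m1 + m2)%N}.
Proof.
move=> m1 m2; rewrite /wdeg -big_split /=.
by apply: eq_bigr => i _; rewrite mnmDE mulnDr.
Qed.

HB.instance Definition _ := isMeasure.Build (size l) (@wdeg T wt l) wdeg0 wdegD.
End WdegMeasure.
Arguments wdeg [T] wt l m.

Definition Fzero (R : comNzRingType) (H : pred nat) (g : nat)
    (L : nat -> seq (nat * nat)) (q : didx) : {mpoly R[size (ngs H g)]} :=
  mvar R (ngs H g) (pa L q) * mvar R (ngs H g) (pb L q)
  - mvar R (ngs H g) (pa L (q.1, 0%N)) * mvar R (ngs H g) (pb L (q.1, 0%N)).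

Definition Fform (k : closedFieldType) (H : pred nat) (g : nat)
    (L : nat -> seq (nat * nat)) (q : didx) :
    {mpoly {mpoly k[size (coefs H g L)]}[size (ngs H g)]} :=
  Fzero _ H g L q
  - \sum_(n <- nongaps H q.1)
      mvar k (coefs H g L) (q, n) *:
        (mvar _ (ngs H g) (pa L (n, 0%N)) * mvar _ (ngs H g) (pb L (n, 0%N))).

Definition syzygies (k : closedFieldType) (H : pred nat) (g : nat)
    (L : nat -> seq (nat * nat)) (eps : didx -> nat -> didx -> int) : Prop :=
  (forall q' n q, eps q' n q \in [:: 0; 1; -1]) /\
  forall q', q' \in syz_dindices H g L ->
    mvar k (ngs H g) (2 * g - 2)%N * Fzero k H g L q'
    + \sum_(n <- nongaps H (2 * g - 2))
        \sum_(q <- dindices H g L | (n + q.1 == 2 * g - 2 + q'.1)%N)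
          (mvar k (ngs H g) n * Fzero k H g L q) *~ eps q' n q = 0.

Definition decompositions (k : closedFieldType) (H : pred nat) (g : nat)
    (L : nat -> seq (nat * nat)) (eps : didx -> nat -> didx -> int)
    (eta : didx -> nat -> didx -> {mpoly k[size (coefs H g L)]})
    (Z : cidx -> 'X_{1..size (ngs H g)})
    (rho : cidx -> {mpoly k[size (coefs H g L)]}) : Prop :=
  [/\ forall j, j \in rho_indices H g L ->
        mdeg (Z j) = 3%N /\ wdeg id (ngs H g) (Z j) = j.2,
      forall j, j \in rho_indices H g L ->
        rho j \is (j.1.1 + (2 * g - 2) - j.2).-homog for (wdeg cwt (coefs H g L)),
      forall q' n q,
        q' \in syz_dindices H g L -> n \in ngs H g -> q \in dindices H g L ->
        (n + q.1 < q'.1 + (2 * g - 2))%N ->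
        eta q' n q \is (q'.1 + (2 * g - 2) - n - q.1).-homog
          for (wdeg cwt (coefs H g L))
    & forall q', q' \in syz_dindices H g L ->
        mvar _ (ngs H g) (2 * g - 2)%N * Fform k H g L q'
        + \sum_(n <- nongaps H (2 * g - 2))
            \sum_(q <- dindices H g L | (n + q.1 == 2 * g - 2 + q'.1)%N)
              (mvar _ (ngs H g) n * Fform k H g L q) *~ eps q' n q
        = \sum_(n <- ngs H g)
            \sum_(q <- dindices H g L | (n + q.1 < q'.1 + (2 * g - 2))%N)
              eta q' n q *: (mvar _ (ngs H g) n * Fform k H g L q)
          + \sum_(m <- nongaps H (q'.1 + (2 * g - 2)))
              rho (q', m) *: 'X_[Z (q', m)]].

(* The nongaps n <= 2g-2 with n - w a nongap. *)
Definition shift_dom (H : pred nat) (g w : nat) : seq nat :=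
  [seq n <- ngs H g | (w <= n)%N && H (n - w)%N].

Definition normalization_map (k : closedFieldType) (H : pred nat) (g : nat)
    (L : nat -> seq (nat * nat)) (w : nat) (Nw : seq cidx)
    (d : {ffun 'I_(size (shift_dom H g w)) -> k}) : {ffun 'I_(size Nw) -> k} :=
  [ffun j => let q := (tnth (in_tuple Nw) j).1 in
     extend0 d (pa L q) + extend0 d (pb L q)
     - extend0 d (pa L (q.1, 0%N)) - extend0 d (pb L (q.1, 0%N))].

Definition normalization (k : closedFieldType) (H : pred nat) (g : nat)
    (L : nat -> seq (nat * nat)) (N : nat -> seq cidx) : Prop :=
  forall w, (0 < w)%N ->
    [/\ uniq (N w),
        {subset N w <= [seq t <- coefs H g L | cwt t == w]},
        size (N w) =
          count (fun m => H (m + w)%N && (m + w <= 2 * g - 2)%N) (ngs H g)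
      & bijective (@normalization_map k H g L w (N w))].

Definition remaining_coefs (H : pred nat) (g : nat)
    (L : nat -> seq (nat * nat)) (N : nat -> seq cidx) : seq cidx :=
  [seq t <- coefs H g L | t \notin N (cwt t)].

(* rho_j with the coefficients outside cs (the normalized ones) set to 0. *)
Definition nrho (k : closedFieldType) (H : pred nat) (g : nat)
    (L : nat -> seq (nat * nat))
    (rho : cidx -> {mpoly k[size (coefs H g L)]}) (cs : seq cidx) (j : cidx) :
    {mpoly k[size cs]} :=
  rho j \mPo [tuple mvar k cs (tnth (in_tuple (coefs H g L)) i)
                | i < size (coefs H g L)].

(* The system E = 0 in the unknowns cs = fs ++ ps is equivalent to
   c_p = phi_p((c_f)_{f in fs}), p in ps. *)
Definition solves (k : closedFieldType) (fs ps : seq cidx)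
    (E : seq {mpoly k[size (fs ++ ps)]}) (phi : cidx -> {mpoly k[size fs]}) :
    Prop :=
  forall c : cidx -> k,
    (forall e, e \in E -> e.@[c \o tnth (in_tuple (fs ++ ps))] = 0) <->
    (forall p, p \in ps -> c p = (phi p).@[c \o tnth (in_tuple fs)]).

(* fs lists c_0, ..., c_r and ps lists c_{r+1}, ..., c_nu. The first solves
   condition exhibits T_H as the graph of a linear map over the space of the
   (c_0, ..., c_r); this forces dim T_H = r + 1, so r is the minimal one.
   J indexes the nu - r equations used for the elimination: they are equations
   whose linear parts already solve for ps, and phi is the polynomial solution,
   which is then unique. *)
Definition elimination (k : closedFieldType) (H : pred nat) (g : nat)
    (L : nat -> seq (nat * nat))
    (rho : cidx -> {mpoly k[size (coefs H g L)]}) (N : nat -> seq cidx)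
    (fs ps J : seq cidx) (lam phi : cidx -> {mpoly k[size fs]}) : Prop :=
  [/\ perm_eq (fs ++ ps) (remaining_coefs H g L N),
      (forall p, p \in ps -> lam p \is 1.-homog) /\
      solves [seq pihomog mdeg 1 (nrho rho (fs ++ ps) j)
                | j <- rho_indices H g L] lam,
      [/\ uniq J, {subset J <= rho_indices H g L} & size J = size ps],
      solves [seq pihomog mdeg 1 (nrho rho (fs ++ ps) j) | j <- J] lam
    & (forall p, p \in ps -> phi p \is (cwt p).-homog for (wdeg cwt fs)) /\
      solves [seq nrho rho (fs ++ ps) j | j <- J] phi].

Definition hpoly (k : closedFieldType) (H : pred nat) (g : nat)
    (L : nat -> seq (nat * nat))
    (rho : cidx -> {mpoly k[size (coefs H g L)]})
    (fs ps : seq cidx) (phi : cidx -> {mpoly k[size fs]}) (j : cidx) :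
    {mpoly k[size fs]} :=
  nrho rho (fs ++ ps) j \mPo
    [tuple let t := tnth (in_tuple (fs ++ ps)) i in
           if t \in ps then phi t else mvar k fs t | i < size (fs ++ ps)].

Definition hpolys (k : closedFieldType) (H : pred nat) (g : nat)
    (L : nat -> seq (nat * nat))
    (rho : cidx -> {mpoly k[size (coefs H g L)]})
    (fs ps J : seq cidx) (phi : cidx -> {mpoly k[size fs]}) :
    seq {mpoly k[size fs]} :=
  [seq hpoly rho ps phi j | j <- rho_indices H g L & j \notin J].

Section Zariski.
Variables (k : closedFieldType) (d : nat).
Local Notation A := ({ffun 'I_d -> k}).
Implicit Types (Y Z : A -> Prop).

Definition zero_locus (E : seq {mpoly k[d]}) : A -> Prop :=
  fun u => forall p, p \in E -> p.@[u] = 0.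

Definition zariski_closed Z : Prop :=
  exists S : {mpoly k[d]} -> Prop,
    forall u, Z u <-> (forall p, S p -> p.@[u] = 0).

Definition closed_in Y Z : Prop :=
  exists2 C, zariski_closed C & forall u, Z u <-> Y u /\ C u.

Definition gm_act (w : 'I_d -> nat) (c : k) (u : A) : A :=
  [ffun i => c ^+ w i * u i].

Definition gm_stable (w : 'I_d -> nat) Z : Prop :=
  forall c u, c != 0 -> Z u -> Z (gm_act w c u).

(* P(Y) = (Y \ {o}) / G_m with the quotient topology: subsets of P(Y) are
   represented by their preimages in Y \ {o}, so the closed ones are the
   G_m-stable relatively closed subsets of Y \ {o}. *)
Definition proj_closed_in (w : 'I_d -> nat) Y Z : Prop :=
  gm_stable w Z /\ closed_in (fun u => Y u /\ u <> [ffun=> 0]) Z.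
End Zariski.

Section KrullDimension.
Variables (T : Type) (closed : (T -> Prop) -> Prop).
Implicit Types A B Z : T -> Prop.

Definition included A B : Prop := forall x, A x -> B x.

Definition irreducible_closed Z : Prop :=
  [/\ closed Z, (exists x, Z x)
    & forall A B, closed A -> closed B ->
        included Z (fun x => A x \/ B x) -> included Z A \/ included Z B].

Definition irreducible_chain (n : nat) (c : nat -> T -> Prop) : Prop :=
  (forall i, (i < n)%N -> irreducible_closed (c i)) /\
  (forall i, (i.+1 < n)%N ->
     included (c i) (c i.+1) /\ ~ included (c i.+1) (c i)).

(* Dimension of the space whose closed sets are given by closed: one less than
   the maximal number of members of a chain, hence -1 for the empty space. *)
Definition has_dim (d : int) : Prop :=
  exists n : nat,
    [/\ d = n%:Z - 1, (exists c, irreducible_chain n c)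
      & forall m c, irreducible_chain m c -> (m <= n)%N].
End KrullDimension.

Definition fweights (fs : seq cidx) (i : 'I_(size fs)) : nat :=
  cwt (tnth (in_tuple fs) i).

(* The compactified moduli space is P(X_H), i.e. the space with closed sets
   proj_closed_in (@fweights fs) (X_H ...). *)
Definition X_H (k : closedFieldType) (H : pred nat) (g : nat)
    (L : nat -> seq (nat * nat))
    (rho : cidx -> {mpoly k[size (coefs H g L)]})
    (fs ps J : seq cidx) (phi : cidx -> {mpoly k[size fs]}) :
    {ffun 'I_(size fs) -> k} -> Prop :=
  zero_locus (hpolys rho ps J phi).

Definition Q_H (k : closedFieldType) (H : pred nat) (g : nat)
    (L : nat -> seq (nat * nat))
    (rho : cidx -> {mpoly k[size (coefs H g L)]})
    (fs ps J : seq cidx) (phi : cidx -> {mpoly k[size fs]}) :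
    {ffun 'I_(size fs) -> k} -> Prop :=
  zero_locus [seq pihomog mdeg 2 h | h <- hpolys rho ps J phi].

(* Main.v *)
(** Call a set of points [alg_dependent r] when any [r] polynomials satisfy a
    nontrivial algebraic relation on it.  Passing to a proper irreducible closed
    subset lowers the admissible [r] by one, so chains of irreducible closed
    subsets have length at most [r]; and if [n] quasi-homogeneous polynomials
    meet a quasi-cone only at its vertex, then the quasi-cone is
    [alg_dependent n.+1].  Conversely, if the chains in the projective quotient
    have length at most [n], then [n] such polynomials exist.  Hence the
    dimension of the quotient is controlled by systems of parameters, for
    whichever positive weights make the set a quasi-cone.

    The cone [Q] is stable under two actions: that of the weights [w], and the
    ordinary scalar one, so also for the weights [2 w - 1].  For the latter the
    quadratic form [h^(2)] is the component of highest weight of [h], since [h]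
    is quasi-homogeneous for [w] with no term of degree less than two.  The
    parameters of [Q] for the weights [2 w - 1] therefore make the coordinate
    ring of [X] finite as well, and bound the dimension of its quotient. *)

From HB Require Import structures.
Require Import Defs.
From mathcomp Require Import all_boot all_order all_algebra.
From Stdlib Require Import Classical ClassicalEpsilon.

Set Implicit Arguments.
Unset Strict Implicit.
Unset Printing Implicit Defensive.
Import Order.TTheory GRing.Theory Num.Theory.

Local Open Scope ring_scope.

(** * Separating the last variable *)

Lemma widen_ord_lift n (i : 'I_n) : widen_ord (leqnSn n) i = lift ord_max i.
Proof. by apply/val_inj; rewrite /= /bump leqNgt ltn_ord. Qed.

Section LastVariable.
Variables (R : comNzRingType) (n : nat).

(** The ring morphism from polynomials in the last variable, over polynomials in the others, to
    polynomials in all variables. Its surjectivity carries the inductions on the number of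
    variables. *)
Definition join_last (q : {poly {mpoly R[n]}}) : {mpoly R[n.+1]} :=
  (map_poly (@mwiden n R) q).['X_ord_max].

Definition extend_point (u : 'I_n -> R) (c : R) (i : 'I_n.+1) : R :=
  oapp u c (unlift ord_max i).

Lemma extend_point_max u c : extend_point u c ord_max = c.
Proof. by rewrite /extend_point unlift_none. Qed.

Lemma extend_point_widen u c i : extend_point u c (widen_ord (leqnSn n) i) = u i.
Proof. by rewrite /extend_point widen_ord_lift liftK. Qed.

Lemma join_last_is_zmod_morphism : zmod_morphism join_last.
Proof. by move=> p q; rewrite /join_last rmorphB hornerD hornerN. Qed.

Lemma join_last_is_monoid_morphism : monoid_morphism join_last.
Proof.
split; rewrite /join_last; first by rewrite rmorph1 hornerC.
by move=> p q; rewrite rmorphM hornerM.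
Qed.

HB.instance Definition _ := GRing.isZmodMorphism.Build _ _ join_last
  join_last_is_zmod_morphism.
HB.instance Definition _ := GRing.isMonoidMorphism.Build _ _ join_last
  join_last_is_monoid_morphism.

Lemma join_last_surj p : exists q, join_last q = p.
Proof.
have joinC r : join_last r%:P = mwiden r by rewrite /join_last map_polyC hornerC.
have joinX : join_last 'X = 'X_ord_max by rewrite /join_last map_polyX hornerX.
elim/mpolyind: p => [|c m p _ _ [q <-]]; first by exists 0; rewrite rmorph0.
exists ((c *: 'X_[[multinom m (widen_ord (leqnSn n) i) | i < n]])%:P
        * 'X^(m ord_max) + q).
rewrite rmorphD rmorphM rmorphXn /=; congr (_ + _).
rewrite joinC joinX mwidenZ mwidenX -scalerAl.
congr (_ *: _); rewrite mpolyXn -mpolyXD; congr 'X_[_].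
apply/mnmP=> i; rewrite mnmDE mulmnE mnm1E.
case: (unliftP ord_max i) => [j ->|->].
  rewrite -widen_ord_lift.
  by rewrite mnmwiden_widen mnmE eqE /= (gtn_eqF (ltn_ord j)) mul0n addn0.
by rewrite mnmwiden_ordmax eqxx mul1n.
Qed.

Lemma meval_join_last (u : 'I_n.+1 -> R) q :
  (join_last q).@[u] =
  (map_poly (meval (fun i => u (widen_ord (leqnSn n) i))) q).[u ord_max].
Proof.
rewrite /join_last -horner_map /= mevalXU -map_poly_comp; congr (_.[_]).
apply: eq_map_poly => p /=; rewrite /mwiden.
elim/mpolyind: p => [|c m p _ _ ih]; first by rewrite !raddf0.
rewrite mmapD !mevalD ih; congr (_ + _).
rewrite mmapZ mmapX mevalM mevalC mevalZ mevalX; congr (_ * _).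
rewrite /mmap1 rmorph_prod; apply: eq_bigr => i _.
by rewrite rmorphXn /= mevalXU.
Qed.
End LastVariable.

(** * Hilbert's basis theorem *)

Lemma choice_fun (A B : Type) (r : A -> B -> Prop) :
  (forall a, exists b, r a b) -> exists f, forall a, r a (f a).
Proof.
move=> ex; exists (fun a => sval (constructive_indefinite_description _ (ex a))).
by move=> a; case: constructive_indefinite_description.
Qed.

Section Ideals.
Variable R : comNzRingType.

Definition is_ideal (I : R -> Prop) : Prop :=
  [/\ I 0, forall x y, I x -> I y -> I (x + y) & forall a x, I x -> I (a * x)].

Definition is_prime (P : R -> Prop) : Prop :=
  [/\ is_ideal P, ~ P 1 & forall x y, P (x * y) -> P x \/ P y].

Definition noetherian : Prop :=
  forall I : nat -> R -> Prop, (forall n, is_ideal (I n)) ->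
    (forall n x, I n x -> I n.+1 x) ->
    exists n, forall m x, (n <= m)%N -> I m x -> I n x.

Lemma is_idealN I x : is_ideal I -> I x -> I (- x).
Proof. by case=> _ _ IM Ix; rewrite -mulN1r; apply: IM. Qed.

Lemma is_idealB I x y : is_ideal I -> I x -> I y -> I (x - y).
Proof. by move=> idI Ix Iy; case: (idI) => _ ID _; apply: ID => //; apply: is_idealN. Qed.

Lemma is_ideal_sum I (T : eqType) (r : seq T) (F : T -> R) : is_ideal I ->
  (forall t, t \in r -> I (F t)) -> I (\sum_(t <- r) F t).
Proof. by case=> I0 ID _ IF; rewrite big_seq; apply: (big_ind I) => // t; apply: IF. Qed.

Lemma ascending_le (I : nat -> R -> Prop) : (forall n x, I n x -> I n.+1 x) ->
  forall m n x, (m <= n)%N -> I m x -> I n x.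
Proof.
move=> up m n x /subnK <-; elim: (n - m)%N => [//|d ih /ih].
by rewrite addSn; apply: up.
Qed.

(** Were there no maximal member, choice would assign to each member a strictly larger one, and
    iterating from [I0] would give an ascending chain that never stabilizes. *)
Lemma noetherian_maximal (Phi : (R -> Prop) -> Prop) (I0 : R -> Prop) :
    noetherian -> (forall I, Phi I -> is_ideal I) -> Phi I0 ->
  exists2 I, Phi I &
    forall J, Phi J -> (forall x, I x -> J x) -> forall x, J x -> I x.
Proof.
move=> noeth idPhi Phi0; apply: NNPP => nmax.
have next (I : {I | Phi I}) : exists J : {J | Phi J},
    (forall x, sval I x -> sval J x) /\ exists2 x, sval J x & ~ sval I x.
  apply: NNPP => nJ; apply: nmax; exists (sval I); first exact: svalP.
  move=> J PhiJ sIJ x Jx; apply: NNPP => nIx; apply: nJ.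
  by exists (exist _ J PhiJ); split=> //; exists x.
have [f fP] := choice_fun next.
pose c n := iter n f (exist _ I0 Phi0).
have [n nP] := noeth (fun n => sval (c n)) (fun n => idPhi _ (svalP (c n)))
  (fun n => (fP (c n)).1).
by have [x fx nx] := (fP (c n)).2; apply: nx; apply: (nP n.+1).
Qed.
End Ideals.

Lemma noetherian_surj (R S : comNzRingType) (f : {rmorphism R -> S}) :
  (forall y, exists x, f x = y) -> noetherian R -> noetherian S.
Proof.
move=> fsurj noeth I idI upI.
have [|n x|n nP] := noeth (fun n x => I n (f x)).
- by move=> n; have [I0 ID IM] := idI n; split=> [|x y|a x];
    rewrite ?rmorph0 ?rmorphD ?rmorphM //; [apply: ID|apply: IM].
- exact: upI.
by exists n => m y lenm; have [x <-] := fsurj y; apply: nP.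
Qed.

Lemma noetherian_field (F : fieldType) : noetherian F.
Proof.
move=> I idI upI.
case: (classic (exists n x, I n x /\ x != 0)) => [[n [x [Ix x0]]]|I0].
  exists n => m y _ _; have [_ _ IM] := idI n.
  by rewrite -[y](divfK x0); apply: IM.
exists 0 => m y _ Imy; have [-> |y0] := eqVneq y 0; first by case: (idI 0%N).
by case: I0; exists m, y.
Qed.

(* The ideals [lead_ideal n I] of the coefficients of 'X^n in the elements of [I] of
   degree at most [n] determine [I] among the ideals containing it. *)
Section HilbertBasis.
Variable R : comNzRingType.

Definition lead_ideal (n : nat) (I : {poly R} -> Prop) (a : R) : Prop :=
  exists p, [/\ I p, (size p <= n.+1)%N & p`_n = a].

Lemma lead_idealP n I : is_ideal I -> is_ideal (lead_ideal n I).
Proof.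
case=> I0 ID IM; split=> [|_ _ [p [Ip sp <-]] [q [Iq sq <-]]|a _ [p [Ip sp <-]]].
- by exists 0; rewrite size_poly0 coef0.
- exists (p + q); split; rewrite ?coefD //; first exact: ID.
  by apply: leq_trans (size_polyD p q) _; rewrite geq_max sp.
exists (a%:P * p); split; rewrite ?coefCM //; first exact: IM.
by rewrite mul_polyC; apply: leq_trans (size_scale_leq _ _) sp.
Qed.

Lemma lead_idealS n I a : is_ideal I -> lead_ideal n I a -> lead_ideal n.+1 I a.
Proof.
case=> _ _ IM [p [Ip sp <-]]; exists ('X * p); split; first exact: IM.
  by rewrite mulrC; apply: leq_trans (size_polyMleq _ _) _; rewrite size_polyX addn2.
by rewrite mulrC coefMX.
Qed.

Lemma lead_ideal_inj (I J : {poly R} -> Prop) : is_ideal I -> is_ideal J ->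
  (forall p, I p -> J p) -> (forall n a, lead_ideal n J a -> lead_ideal n I a) ->
  forall p, J p -> I p.
Proof.
move=> idI idJ sIJ leadJI p; move: {2}(size p) (leqnn (size p)) => n.
elim: n p => [|n ih] p sp Jp.
  by move: sp; rewrite leqn0 size_poly_eq0 => /eqP->; case: idI.
have [q [Iq sq eqpq]] := leadJI n p`_n (ex_intro _ p (And3 Jp sp erefl)).
have [I0 ID _] := idI; rewrite -[p](subrK q); apply: (ID) => //; apply: ih.
  apply/leq_sizeP => i; rewrite leq_eqVlt coefB => /orP[/eqP<-|lt_ni].
    by rewrite eqpq subrr.
  by rewrite !nth_default ?subrr //; apply: leq_trans lt_ni.
by apply: is_idealB => //; apply: sIJ.
Qed.

(** The diagonal chain [lead_ideal n (I n)] is constant from some [M] on, which settles all degrees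
    at least [M]; the finitely many degrees below [M] stabilize by a common index [K]. *)
Lemma noetherian_poly : noetherian R -> noetherian {poly R}.
Proof.
move=> noeth I idI upI.
have leI := ascending_le upI.
have leadI n m m' a : (m <= m')%N -> lead_ideal n (I m) a -> lead_ideal n (I m') a.
  by move=> lem [p [Ip sp pa]]; exists p; split=> //; apply: leI Ip.
have leadn m n n' a : (n <= n')%N -> lead_ideal n (I m) a -> lead_ideal n' (I m) a.
  by apply: (@ascending_le R (fun n => lead_ideal n (I m))) => i x;
    apply: lead_idealS.
have [|n x|M MP] := noeth (fun n => lead_ideal n (I n)).
- by move=> n; apply: lead_idealP.
- by move/(lead_idealS (idI n)); apply: leadI.
have [K KP] : exists K, forall n m a, (n < M)%N ->
    lead_ideal n (I m) a -> lead_ideal n (I K) a.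
  elim: (M) => [|M' [K KP]]; first by exists 0.
  have [||K' K'P] := noeth (fun m => lead_ideal M' (I m)).
  - by move=> m; apply: lead_idealP.
  - by move=> m x; apply: leadI.
  exists (maxn K K') => n m a; rewrite ltnS leq_eqVlt => /orP[/eqP-> ma|lt ma].
    apply: (leadI) (leq_maxr K K') _; case: (leqP K' m) => leK; first exact: K'P ma.
    exact: leadI (ltnW leK) ma.
  by apply: (leadI) (leq_maxl K K') _; apply: KP lt ma.
exists (maxn M K) => m p le_m; move: p; apply: lead_ideal_inj => //.
  by move=> p; apply: leI.
move=> n a; case: (ltnP n M) => [lt|le] na.
  by apply: (leadI) (leq_maxr M K) _; apply: KP lt na.
apply: (leadI) (leq_maxl M K) _; apply: (leadn _ _ _ _ (le)).
apply: (MP (maxn n m)); first exact: leq_trans le (leq_maxl _ _).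
by apply: (leadI) (leq_maxr n m) _; apply: leadn (leq_maxl n m) na.
Qed.
End HilbertBasis.

Lemma noetherian_mpoly (F : fieldType) n : noetherian {mpoly F[n]}.
Proof.
elim: n => [|n ih].
  apply: (@noetherian_surj F _ (@mpolyC 0 F)); last exact: noetherian_field.
  by move=> p; exists p@_0%MM; exact: mpolyKC.
apply: (@noetherian_surj {poly {mpoly F[n]}} _ (@join_last F n)).
  exact: join_last_surj.
exact: noetherian_poly.
Qed.

(** * The Nullstellensatz *)

Lemma exists_minimal (T : Type) (P : T -> Prop) (f : T -> nat) :
  (exists x, P x) -> exists2 x, P x & forall y, P y -> (f x <= f y)%N.
Proof.
case=> x Px; move: {2}(f x) (leqnn (f x)) => n.
elim: n x Px => [|n ih] x Px fx.
  by exists x => // y _; apply: leq_trans fx _.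
case: (classic (exists2 y, P y & (f y < f x)%N)) => [[y Py fy]|nmin].
  by apply: (ih y) => //; rewrite -ltnS; apply: leq_trans fy fx.
exists x => // y Py; rewrite leqNgt; apply/negP => fy.
by apply: nmin; exists y.
Qed.

Section Primes.
Variable R : comNzRingType.
Variables (P : R -> Prop).
Hypothesis primeP : is_prime P.

Lemma is_primeX x n : P (x ^+ n) -> P x.
Proof.
have [_ P1 PM] := primeP.
elim: n => [|n ih]; first by rewrite expr0 => /P1.
by rewrite exprS => /PM[].
Qed.
End Primes.

(** If [x] is not in [P], the ideal [J] generated by [P] and [x] contains 1, so some [1 - a * x]
    lies in [P]; multiplying by [y] puts [y] in [P] once [x * y] is. *)
Lemma maximal_prime (R : comNzRingType) (P : R -> Prop) :
  is_ideal P -> ~ P 1 ->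
  (forall J, is_ideal J /\ ~ J 1 -> (forall x, P x -> J x) ->
     forall x, J x -> P x) -> is_prime P.
Proof.
move=> idP P1 maxP; split=> // x y Pxy; apply: NNPP => /not_or_and[nx ny].
have [P0 PD PM] := idP.
pose J z := exists a, P (z - a * x).
have sPJ z : P z -> J z by exists 0; rewrite mul0r subr0.
have Jx : J x by exists 1; rewrite mul1r subrr.
apply: nx; apply: (maxP J) => //; split=> [|[a Pa]].
  split=> [|z t [a Pa] [b Pb]|z t [a Pa]]; first exact: sPJ.
    exists (a + b); rewrite mulrDl opprD addrACA; exact: PD.
  by exists (z * a); rewrite -mulrA -mulrBr; apply: PM.
apply: ny; rewrite -[y](subrK (a * (x * y))); apply: PD; last exact: PM.
by rewrite mulrA -{1}[y]mul1r -mulrBl mulrC; apply: PM.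
Qed.

Section PointExtension.
Variables (k : closedFieldType) (R : idomainType).
Variables (P : {poly R} -> Prop) (s : {poly R}).
Hypotheses (primeP : is_prime P) (Ps : ~ P s).

Let idP : is_ideal P. Proof. by case: primeP. Qed.

(** The contraction of [P] to the coefficient ring. *)
Definition constants (a : R) : Prop := P a%:P.

Lemma constants_prime : is_prime constants.
Proof.
rewrite /constants; have [[P0 PD PM] P1 Pp] := primeP.
split=> [|//|x y]; last by rewrite polyCM; apply: Pp.
split=> [|x y|a x]; rewrite ?polyCD ?polyCM //; [exact: PD | exact: PM].
Qed.

Lemma constants_coef (p : {poly R}) : (forall i, constants p`_i) -> P p.
Proof.
move=> pc; rewrite -[p]coefK poly_def; apply: is_ideal_sum => // i _.
by rewrite -mul_polyC mulrC; case: idP => _ _; apply; apply: pc.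
Qed.

(** Leading terms are stripped one at a time: each lies in [P], hence in [I], and leaves a shorter
    element of [I]. *)
Lemma lead_constants (I : {poly R} -> Prop) n :
  is_ideal I -> (forall p, P p -> I p) ->
  (forall p, I p -> (size p <= n)%N -> constants (lead_coef p)) ->
  forall p, I p -> (size p <= n)%N -> forall i, constants p`_i.
Proof.
move=> idI sPI Ilead p; have [[C0 CD _] _ _] := constants_prime.
move: {2}(size p) (leqnn (size p)) => m.
elim: m p => [|m ih] p.
  by rewrite leqn0 size_poly_eq0 => /eqP-> _ _ i; rewrite coef0.
move=> spm Ip spn i; pose l := (lead_coef p)%:P * 'X^((size p).-1).
have Pl : P l.
  by rewrite /l mulrC; case: idP => _ _; apply; apply: Ilead.
have coefl j : l`_j = lead_coef p *+ (j == (size p).-1).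
  by rewrite coefCM coefXn mulr_natr.
rewrite -[p](subrK l) coefD; apply: CD; last first.
  by rewrite coefl; case: eqP => _; [apply: Ilead | rewrite mulr0n].
have spl : (size (p - l)%R <= (size p).-1)%N.
  apply/leq_sizeP => j lej; rewrite coefB coefl; case: (ltngtP j (size p).-1) lej => //.
    move=> ltj _; rewrite subr0 nth_default //.
    by case: (size p) ltj.
  by move=> -> _; rewrite lead_coefE subrr.
apply: ih.
- by apply: leq_trans spl _; case: (size p) spm.
- by apply: is_idealB => //; apply: sPI.
- by apply: leq_trans spl _; apply: leq_trans (leq_pred _) spn.
Qed.

(* If [P] contains a polynomial [f] whose leading coefficient is not in [P], take
   it of minimal degree: outside the zeros of that coefficient, the roots of [f]
   are roots of all of [P] by pseudo-division.  A combination of [s] and [P] of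
   minimal degree is then a constant [r], and [r <> 0] keeps [s] nonzero. *)
Lemma point_extension : exists2 r, ~ constants r &
  forall f : {rmorphism R -> k}, (forall a, constants a -> f a = 0) ->
    f r != 0 -> exists c, (forall p, P p -> (map_poly f p).[c] = 0) /\
                          (map_poly f s).[c] != 0.
Proof.
have [idC C1 CP] := constants_prime; have [C0 CD CM] := idC.
have [_ PD PM] := idP; have [_ P1 Pp] := primeP.
case: (classic (exists f, P f /\ ~ constants (lead_coef f))); last first.
  (* Here all coefficients of elements of [P] lie in the contraction, so the morphism kills [P] and
     [c] only has to avoid the roots of the image of [s]. *)
  move=> nolead; have Pcoef p : P p -> forall i, constants p`_i.
    move=> Pp0; apply: (lead_constants (n := size p) idP) => // q Pq _.
    by apply: NNPP => nq; apply: nolead; exists q.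
  have [i Ci] : exists i, ~ constants s`_i.
    by apply: not_all_ex_not => Cs; apply: Ps; apply: constants_coef.
  exists s`_i => // f f0 fi.
  have /closed_nonrootP[c rc] : map_poly f s != 0.
    by apply: contraNneq fi => s0; rewrite -coef_map s0 coef0.
  exists c; split=> // p Pp0; rewrite (_ : map_poly f p = 0) ?horner0 //.
  by apply/polyP => j; rewrite coef_map coef0; apply/f0/Pcoef.
case/(exists_minimal (fun f : {poly R} => size f)) => f [Pf nlf] minf.
have lead_small p : P p -> (size p < size f)%N -> forall i, constants p`_i.
  move=> Pp0 sp; apply: (lead_constants (n := size p) idP) => // q Pq sq.
  apply: NNPP => nq; have := minf q (conj Pq nq).
  by rewrite leqNgt (leq_ltn_trans sq sp).
pose I u := exists v, P (u - v * s).
have sPI p : P p -> I p by exists 0; rewrite mul0r subr0.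
have Is : I s by exists 1; rewrite mul1r subrr; case: idP.
have idI : is_ideal I.
  split=> [|x y [a Pa] [b Pb]|x y [a Pa]]; first by apply: sPI; case: idP.
    by exists (a + b); rewrite mulrDl opprD addrACA; apply: PD.
  by exists (x * a); rewrite -mulrA -mulrBr; apply: PM.
have [u [Iu nlu] minu] : exists2 u, I u /\ ~ constants (lead_coef u) &
    forall v, I v /\ ~ constants (lead_coef v) -> (size u <= size v)%N.
  by apply: exists_minimal; exists f; split=> //; apply: sPI.
have small_P p : I p -> (size p < size u)%N -> P p.
  move=> Ip sp; apply: constants_coef.
  apply: (lead_constants (n := size p) idI) => // q Iq sq.
  apply: NNPP => nq; have := minu q (conj Iq nq).
  by rewrite leqNgt (leq_ltn_trans sq sp).
have nC0 (p : {poly R}) : ~ constants (lead_coef p) -> p != 0.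
  by move=> nlp; apply/eqP => p0; apply: nlp; rewrite p0 lead_coef0.
have I_mod p : I p -> I (p %% u)%R.
  move=> Ip; have [_ _ IM] := idI.
  have -> : p %% u = (lead_coef u ^+ scalp p u)%:P * p - p %/ u * u.
    by rewrite mul_polyC Pdiv.Idomain.divp_eq addrC addKr.
  by apply: is_idealB => //; apply: IM.
have P_mod p : I p -> P (p %% u)%R.
  by move=> Ip; apply: small_P; [exact: I_mod | rewrite ltn_modp nC0].
have nPlX (N : nat) : ~ constants (lead_coef u ^+ N).
  by move/(is_primeX constants_prime).
(* Otherwise pseudo-division of [s] by [u] would put a power of the leading coefficient of [u],
   times [s], in the prime [P]. *)
have nPu : ~ P u.
  move=> Pu; have: P ((lead_coef u ^+ scalp s u)%:P * s).
    rewrite mul_polyC Pdiv.Idomain.divp_eq; apply: PD; first exact: PM.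
    exact: P_mod.
  by case/Pp => //; apply: nPlX.
(* Were [u] nonconstant, the pseudo-quotient of [f] by [u] would lie in [P] and be shorter than [f].
   Its leading coefficient would then be in the contraction, and so would that of [f]. *)
have su : (size u <= 1)%N.
  rewrite leqNgt; apply/negP => su.
  have := P_mod f (sPI _ Pf).
  have eqf := Pdiv.Idomain.divp_eq f u.
  have Pqu : P (f %/ u * u).
    have -> : f %/ u * u = (lead_coef u ^+ scalp f u)%:P * f - f %% u.
      by rewrite mul_polyC eqf addrK.
    by apply: is_idealB => //; [apply: PM | apply/P_mod/sPI].
  case/Pp: Pqu => // Pq _.
  have lu0 : lead_coef u ^+ scalp f u != 0 by rewrite expf_neq0 // lead_coef_eq0 nC0.
  have szq : (size (f %/ u)%R < size f)%N.
    rewrite size_divp ?nC0 // ltn_subrL lt0n [X in _ && X]lt0n size_poly_eq0 nC0 //.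
    by rewrite andbT -lt0n -ltnS prednK // (ltn_trans _ su).
  have ltm : (size (f %% u)%R < size (f %/ u * u)%R)%N.
    have := ltn_modp f u; rewrite nC0 // => ltm.
    apply: leq_trans ltm _.
    have q0 : f %/ u != 0.
      rewrite divpN0 ?nC0 //; exact: minu (conj (sPI _ Pf) nlf).
    rewrite size_mul ?(nC0 u) //; move: q0; rewrite -size_poly_gt0.
    by case: (size _) => // a _; rewrite addSn leq_addl.
  have := congr1 lead_coef eqf.
  rewrite lead_coefZ lead_coefDl //. rewrite lead_coefM => eql.
  have: constants (lead_coef u ^+ scalp f u * lead_coef f).
    rewrite eql mulrC; apply: CM; rewrite lead_coefE; exact: lead_small.
  by case/CP; [apply: nPlX | ].
have {su} [r eqr nr] : exists2 r, u = r%:P & ~ constants r.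
  by have := size1_polyC su => equ; exists u`_0 => //; rewrite /constants -equ.
have sf : (1 < size f)%N.
  rewrite ltnNge; apply/negP => /size1_polyC eqf.
  by apply: nlf; rewrite eqf lead_coefC /constants -eqf.
exists (lead_coef f * r) => [/CP[]//|phi phi0].
rewrite rmorphM mulf_eq0 => /norP[phif phir].
have szf : size (map_poly phi f) = size f by rewrite size_map_poly_id0.
have /closed_rootP[c /rootP rc] : size (map_poly phi f) != 1%N.
  by rewrite szf neq_ltn sf orbT.
have vanish p : P p -> (map_poly phi p).[c] = 0.
  move=> Pp0; have rem0 : map_poly phi (p %% f) = 0.
    apply/polyP => i; rewrite coef_map coef0; apply/phi0/lead_small.
      have -> : p %% f = (lead_coef f ^+ scalp p f)%:P * p - p %/ f * f.
        by rewrite mul_polyC Pdiv.Idomain.divp_eq addrC addKr.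
      by apply: is_idealB => //; apply: PM.
    by rewrite ltn_modp nC0.
  have := congr1 (fun q => (map_poly phi q).[c]) (Pdiv.Idomain.divp_eq p f).
  rewrite /= map_polyZ /= rmorphD rmorphM hornerZ hornerD hornerM rc mulr0 add0r /= rem0 horner0.
  by move/eqP; rewrite mulf_eq0 rmorphXn /= (negPf (expf_neq0 _ _)) // => /eqP.
exists c; split=> //; case: Iu => v /vanish.
rewrite eqr rmorphB rmorphM hornerD hornerN hornerM /= map_polyC hornerC.
by move/eqP; rewrite subr_eq0 => /eqP eqs; apply: contraNneq phir => s0;
  rewrite eqs s0 mulr0.
Qed.
End PointExtension.

(** Induction on the number of variables through [point_extension]. Keeping a given [s] nonzero is
    what lets the induction pass: the [r] of [point_extension] plays that role one variable
    below. *)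
Lemma prime_has_point (k : closedFieldType) n (P : {mpoly k[n]} -> Prop) s :
  is_prime P -> ~ P s ->
  exists u, (forall p, P p -> p.@[u] = 0) /\ s.@[u] != 0.
Proof.
elim: n P s => [|n ih] P s primeP Ps.
  have [[P0 PD PM] P1 Pp] := primeP.
  have const (p : {mpoly k[0]}) : p = (p@_0%MM)%:MP.
    by apply/esym; exact: mpolyKC.
  exists (fun _ => 0); split=> [p Pp0|].
    rewrite [p]const mevalC; apply/eqP; apply/negP => /negP p0; apply: P1.
    by rewrite -mpolyC1 -(mulVf p0) mpolyCM; apply: PM; rewrite -const.
  rewrite [s]const mevalC; apply/negP => /eqP s0; apply: Ps.
  by rewrite [s]const s0 mpolyC0.
have [t eqt] := join_last_surj s.
pose Q q := P (join_last q).
have primeQ : is_prime Q.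
  have [[P0 PD PM] P1 Pp] := primeP.
  split=> [||x y]; rewrite /Q ?rmorph1 ?rmorphM //; last exact: Pp.
  by split=> [|x y|a x]; rewrite ?rmorph0 ?rmorphD ?rmorphM //; [exact: PD|exact: PM].
have Qt : ~ Q t by rewrite /Q eqt.
have [r nr rP] := @point_extension k _ _ _ primeQ Qt.
have [u [u0 ur]] := ih _ r (constants_prime primeQ) nr.
have [c [c0 ct]] := rP (meval u) u0 ur.
exists (extend_point u c).
have ev q : (join_last q).@[extend_point u c] = (map_poly (meval u) q).[c].
  rewrite meval_join_last extend_point_max; congr (_.[_]).
  by apply: eq_map_poly => p; apply: meval_eq => i; rewrite extend_point_widen.
split=> [p|]; last by rewrite -eqt ev.
by have [q <-] := join_last_surj p; rewrite ev; apply: c0.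
Qed.

(** An ideal maximal among the proper ones containing [I] exists by noetherianity and is prime, so
    it has a zero. *)
Theorem weak_nullstellensatz (k : closedFieldType) n (I : {mpoly k[n]} -> Prop) :
  is_ideal I -> ~ I 1 -> exists u, forall p, I p -> p.@[u] = 0.
Proof.
move=> idI I1.
pose Phi (J : {mpoly k[n]} -> Prop) :=
  [/\ is_ideal J, ~ J 1 & forall x, I x -> J x].
have [P [idP P1 sIP] maxP] : exists2 P, Phi P &
    forall J, Phi J -> (forall x, P x -> J x) -> forall x, J x -> P x.
  by apply: noetherian_maximal (@noetherian_mpoly k n) _ (_ : Phi I) => // J [].
have [||u [u0 _]] := @prime_has_point k n P 1 => //; last first.
  by exists u => p Ip; apply/u0/sIP.
apply: maximal_prime => // J [idJ J1] sPJ; apply: maxP => //.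
by split=> // x Ix; apply/sPJ/sIP.
Qed.

(** * Graded ideals *)

Section Homogeneous.
Variables (R : comNzRingType) (d : nat) (mf : measure d).
Implicit Types p q : {mpoly R[d]}.

(** [mmeasure] is one more than the largest weight of a monomial, and 0 for the zero polynomial;
    hence the strict inequality here and the successors below. *)
Lemma mmeasure_leP n p :
  reflect {in msupp p, forall m, (mf m < n)%N} (mmeasure mf p <= n)%N.
Proof.
apply: (iffP idP) => [le m /(mmeasure_mnm_lt mf) lt|lt]; first exact: leq_trans le.
by rewrite mmeasureE; apply/bigmax_leqP_seq => m /lt.
Qed.

Lemma mmeasure_homogM e n p q : p \is e.-homog for mf ->
  (mmeasure mf q <= n)%N -> (mmeasure mf (p * q) <= e + n)%N.
Proof.
move=> /dhomogP hp /mmeasure_leP hq; apply/mmeasure_leP => m.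
move/msuppM_le/allpairsP => [[m1 m2] /= [/hp h1 /hq h2 ->]].
by rewrite mfD h1 ltn_add2l.
Qed.

Lemma mmeasure_homog e p : p \is e.-homog for mf -> (mmeasure mf p <= e.+1)%N.
Proof. by move=> /dhomogP hp; apply/mmeasure_leP => m /hp ->. Qed.

Lemma mmeasure_le0 p : (mmeasure mf p <= 0)%N -> p = 0.
Proof.
move/mmeasure_leP => h; apply: msuppnil0.
by case: (msupp p) h => // m s /(_ m (mem_head _ _)).
Qed.

Lemma mcoeff_pihomog n p m :
  (pihomog mf n p)@_m = if mf m == n then p@_m else 0.
Proof.
elim/mpolyind: p => [|c m' p _ _ ih]; first by rewrite raddf0 mcoeff0; case: ifP.
rewrite linearD linearZ /= !mcoeffD !mcoeffZ ih pihomogX mcoeffX.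
have [<-|ne] := eqVneq m' m; first by case: ifP; rewrite ?mcoeffX ?mcoeff0 ?eqxx ?mulr0 ?addr0.
by case: (mf m' == n); rewrite ?mcoeffX ?mcoeff0 ?(negPf ne) mulr0 !add0r.
Qed.

Lemma pihomog_gt n p : (mmeasure mf p <= n)%N -> pihomog mf n p = 0.
Proof.
move=> /mmeasure_leP hp; apply/mpolyP => m; rewrite mcoeff_pihomog mcoeff0.
case: eqP => // em; apply/eqP; rewrite mcoeff_eq0; apply/negP => /hp.
by rewrite em ltnn.
Qed.

Lemma pihomogM e n p q : q \is e.-homog for mf ->
  pihomog mf n (p * q) = if (e <= n)%N then pihomog mf (n - e) p * q else 0.
Proof.
move=> hq; rewrite {1}(pihomog_partitionE (leqnn (mmeasure mf p))).
rewrite mulr_suml linear_sum /=.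
have term (t : nat) : pihomog mf n (pihomog mf t p * q) =
    if n == (t + e)%N then pihomog mf t p * q else 0.
  have h := dhomogM (pihomogP mf t p) hq.
  by case: eqP h => [-> h|/eqP/negPf ne h]; [exact: pihomog_dE |
    apply: pihomog_ne0 h; rewrite eq_sym ne].
under eq_bigr do rewrite term.
case: leqP => [le_en|lt_ne]; last first.
  by rewrite big1 // => t _; rewrite ltn_eqF // ltn_addl.
rewrite -big_mkcond /=.
case: (ltnP (n - e) (mmeasure mf p)) => [lt|le].
  rewrite (big_pred1 (Ordinal lt)) // => t.
  by rewrite /= -val_eqE -[RHS](eqn_add2r e) /= subnK // eq_sym.
rewrite big1 => [|t /eqP eqn]; last first.
  by have := leq_trans (ltn_ord t) le; rewrite eqn addnK ltnn.
by rewrite pihomog_gt ?mul0r.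
Qed.

Lemma meval_homog (v : 'I_d -> nat) e p (u : 'I_d -> R) c :
  (forall i, mf U_(i)%MM = v i) -> p \is e.-homog for mf ->
  p.@[fun i => c ^+ v i * u i] = c ^+ e * p.@[u].
Proof.
move=> mfU /dhomogP hp; rewrite !mevalE mulr_sumr big_seq [RHS]big_seq.
apply: eq_bigr => m mp; rewrite mulrCA; congr (_ * _).
under eq_bigr do rewrite exprMn -exprM.
rewrite big_split /= prodrXr -(hp m mp) mfE; congr (_ ^+ _ * _).
by apply: eq_bigr => i _; rewrite mfU mulnC.
Qed.
End Homogeneous.

Definition idspan (R : comNzRingType) (J : finType) (q : J -> R) (p : R) : Prop :=
  exists a : J -> R, p = \sum_j a j * q j.

Lemma idspan_ideal (R : comNzRingType) (J : finType) (q : J -> R) :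
  is_ideal (idspan q).
Proof.
split=> [|_ _ [a ->] [b ->]|x _ [a ->]].
- by exists (fun=> 0); rewrite big1 // => j _; rewrite mul0r.
- by exists (fun j => a j + b j); rewrite -big_split; apply: eq_bigr => j _; rewrite mulrDl.
by exists (fun j => x * a j); rewrite mulr_sumr; apply: eq_bigr => j _; rewrite mulrA.
Qed.

Lemma idspan_gen (R : comNzRingType) (J : finType) (q : J -> R) j : idspan q (q j).
Proof.
exists (fun i => (i == j)%:R); rewrite (bigD1 j) //= eqxx mul1r big1 ?addr0 //.
by move=> i /negPf->; rewrite mul0r.
Qed.

Section GradedNullstellensatz.
Variables (k : closedFieldType) (d : nat) (mf : measure d) (J : finType).
Variables (q : J -> {mpoly k[d]}) (e : J -> nat).
Hypothesis mf_gt0 : forall i, (0 < mf U_(i)%MM)%N.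
Hypothesis q_homog : forall j, q j \is (e j).-homog for mf.

(** Since the generators are homogeneous, each coefficient can be replaced by its component of
    complementary weight. The weights recorded here give the degree control in [exists_spanned]. *)
Lemma idspan_pihomog n p : idspan q p ->
  exists2 a : J -> {mpoly k[d]}, pihomog mf n p = \sum_j a j * q j &
    forall j, (e j <= n)%N /\ a j \is (n - e j).-homog for mf \/ a j = 0.
Proof.
case=> a ->.
exists (fun j => if (e j <= n)%N then pihomog mf (n - e j) (a j) else 0).
  rewrite linear_sum; apply: eq_bigr => j _ /=.
  by rewrite (pihomogM _ _ (q_homog j)); case: ifP => // _; rewrite mul0r.
by move=> j; case: ifP => le; [left; split; rewrite ?pihomogP | right].
Qed.

(** The generators have no common zero with [X_i = 1], so 1 is congruent to some [b * (X_i - 1)].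
    Comparing components, [X_i ^ l] is congruent to minus the component of [b] of weight [l * w],
    which vanishes for large [l]. *)
Lemma variable_power_in_span i :
  (forall u, (forall j, (q j).@[u] = 0) -> u i = 0) ->
  exists l, idspan q ('X_i ^+ l).
Proof.
move=> q0.
have idI := idspan_ideal q; have [I0 ID IM] := idI.
pose K p := exists b, idspan q (p - b * ('X_i - 1)).
have K1 : K 1.
  apply: NNPP => nK1; have [|u uK] := @weak_nullstellensatz k d K _ nK1.
    split=> [|x y [a Ia] [b Ib]|x y [b Ib]].
    - by exists 0; rewrite mul0r subrr.
    - by exists (a + b); rewrite mulrDl opprD addrACA; apply: ID.
    by exists (x * b); rewrite -mulrA -mulrBr; apply: IM.
  have u0 j : (q j).@[u] = 0.
    by apply: uK; exists 0; rewrite mul0r subr0; apply: idspan_gen.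
  have : ('X_i - 1 : {mpoly k[d]}).@[u] = 0.
    by apply: uK; exists 1; rewrite mul1r subrr.
  rewrite mevalB mevalXU meval1 q0 // sub0r => /eqP.
  by rewrite oppr_eq0 oner_eq0.
have {K1} [b Ib] := K1; set w := mf U_(i)%MM.
have Xi_homog : ('X_i : {mpoly k[d]}) \is w.-homog for mf by rewrite dhomogX.
have Ib_n n : idspan q (pihomog mf n (1 - b * ('X_i - 1))).
  by have [a -> _] := idspan_pihomog n Ib; exists a.
have pi1 n : pihomog mf n (1 : {mpoly k[d]}) = if n == 0%N then 1 else 0.
  by rewrite -mpolyX0 pihomogX mf0 eq_sym.
have Bl l : idspan q ('X_i ^+ l + pihomog mf (l * w) b).
  elim: l => [|l ih].
    have := Ib_n 0%N; rewrite mulrBr mulr1 !raddfB /= pi1 eqxx (pihomogM _ _ Xi_homog).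
    by rewrite leqNgt mf_gt0 /= oppr0 sub0r opprK.
  have := Ib_n (l.+1 * w)%N; rewrite mulrBr mulr1 !raddfB /= pi1.
  rewrite muln_eq0 /= (gtn_eqF (mf_gt0 i)) (pihomogM _ _ Xi_homog).
  rewrite mulSn leq_addr addKn add0r opprK => Il.
  have := ID _ _ (IM 'X_i _ ih) Il.
  by rewrite mulrDr -exprS ['X_i * pihomog _ _ _]mulrC addrA addrK.
exists (mmeasure mf b); have := Bl (mmeasure mf b).
by rewrite pihomog_gt ?addr0 // leq_pmulr ?mf_gt0.
Qed.

(** Every variable has a power in the ideal, and a monomial of large weight is divisible by one of
    these powers. *)
Theorem graded_nullstellensatz :
  (forall u, (forall j, (q j).@[u] = 0) -> forall i, u i = 0) ->
  exists D, forall m, (D <= mf m)%N -> idspan q 'X_[m].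
Proof.
move=> q0.
have ex_l i : exists l, idspan q ('X_i ^+ l).
  by apply: variable_power_in_span => u /q0.
have [l lP] := choice_fun ex_l.
exists (\sum_i l i * mf U_(i)%MM).+1 => m; rewrite mfE => le_m.
have [i le_i] : exists i, (l i <= m i)%N.
  apply: NNPP => nle; move: le_m; rewrite ltnNge; case/negP; apply: leq_sum => i _.
  rewrite leq_mul2r; apply/orP; right; rewrite leqNgt; apply/negP => lt.
  by apply: nle; exists i; apply: ltnW.
have -> : m = (m - U_(i) *+ l i + U_(i) *+ l i)%MM.
  rewrite submK //; apply/mnm_lepP => j; rewrite mulmnE mnm1E.
  by case: eqP => [<-|_]; rewrite ?mul1n ?mul0n.
have [_ _ IM] := idspan_ideal q.
by rewrite mpolyXD -mpolyXn; apply: IM.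
Qed.
End GradedNullstellensatz.

(** * Algebraic dependence from systems of parameters *)

Lemma exists_linear_relation (F : fieldType) (P Q : finType) (M : P -> Q -> F) :
  (#|Q| < #|P|)%N ->
  exists2 x : P -> F, (exists p, x p != 0) & forall t, \sum_p x p * M p t = 0.
Proof.
move=> ltQP; pose A := \matrix_(i < #|P|, j < #|Q|) M (enum_val i) (enum_val j).
have ker_n0 : kermx A != 0.
  by rewrite -mxrank_eq0 mxrank_ker subn_eq0 -ltnNge (leq_ltn_trans (rank_leq_col A)).
pose v := nz_row (kermx A).
have v0 : v != 0 by rewrite nz_row_eq0.
have vA : v *m A = 0 by apply/sub_kermxP/nz_row_sub.
exists (fun p => v 0 (enum_rank p)).
  case/rV0Pn: v0 => i vi; exists (enum_val i); by rewrite enum_valK.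
move=> t; have := congr1 (fun B : 'rV_#|Q| => B 0 (enum_rank t)) vA.
rewrite !mxE => vA0; rewrite -[RHS]vA0 (reindex (fun i : 'I_#|P| => enum_val i)) /=; last first.
  by exists enum_rank => i _; rewrite (enum_rankK, enum_valK).
by apply: eq_bigr => i _; rewrite mxE enum_valK enum_rankK.
Qed.

(** For irreducible [Z] this says that the function field has transcendence degree less than [r];
    the present form makes sense for every set of points. *)
Definition alg_dependent (k : closedFieldType) (d r : nat)
    (Z : {ffun 'I_d -> k} -> Prop) : Prop :=
  forall g : 'I_r -> {mpoly k[d]}, exists2 F : {mpoly k[r]}, F != 0 &
    forall u, Z u -> F.@[fun i => (g i).@[u]] = 0.

Lemma mmeasureM_leS (R : comNzRingType) d (mf : measure d) (p q : {mpoly R[d]}) a b :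
  (mmeasure mf p <= a.+1)%N -> (mmeasure mf q <= b.+1)%N ->
  (mmeasure mf (p * q) <= (a + b).+1)%N.
Proof.
move=> /mmeasure_leP hp /mmeasure_leP hq; apply/mmeasure_leP => m.
move/msuppM_le/allpairsP => [[m1 m2] /= [/hp h1 /hq h2 ->]].
by rewrite mfD ltnS leq_add.
Qed.

Lemma card_bmultinom_le n K : (#|{: 'X_{1..n < K.+1}}| <= K.+1 ^ n)%N.
Proof.
rewrite -[X in (_ <= _ ^ X)%N]card_ord -[X in (_ <= X ^ _)%N]card_ord -card_ffun.
apply: (@leq_card _ _ (fun m : 'X_{1..n < K.+1} => [ffun i => inord (m i) : 'I_K.+1])).
have small (m : 'X_{1..n < K.+1}) i : (m i < K.+1)%N.
  apply: leq_ltn_trans (bmdeg m); rewrite mdegE (bigD1 i) //=; exact: leq_addr.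
move=> m1 m2 eqm; apply/val_inj/mnmP => i /=.
have /ffunP/(_ i) := eqm; rewrite !ffunE => /(congr1 val) /=.
by rewrite !inordK.
Qed.

(** The left side is at most [S * K ^ n * N ^ n], of degree [n] in [N]. It will bound a number of
    linear equations, and the right side will count the unknowns. *)
Lemma counting_bound S c n :
  exists2 N, (0 < N)%N & (S * (c * (n.+1 * N)).+2 ^ n < N ^ n.+1)%N.
Proof.
pose K := (c * n.+1 + 2)%N.
have [N ltN] : exists N, (S * K ^ n < N)%N by exists (S * K ^ n).+1.
have N_gt0 : (0 < N)%N by case: N ltN.
exists N => //.
have le_K : ((c * (n.+1 * N)).+2 <= K * N)%N.
  by rewrite /K mulnDl mulnA -addn2 leq_add2l leq_pmulr.
apply: (@leq_ltn_trans (S * (K * N) ^ n)%N).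
  rewrite leq_mul2l; apply/orP; right.
  by case: (posnP n) => [->//|n_gt0]; rewrite leq_exp2r.
by rewrite expnMn mulnA expnS ltn_pmul2r // expn_gt0 N_gt0.
Qed.

(* Modulo the top components [q j], every monomial of large degree lies in the
   ideal of the [f i]; since [h j] and [q j] agree up to terms of lower degree,
   the functions on the zero locus of [h] are then spanned by finitely many
   monomials over the polynomials in the [f i], with a linear control of
   degrees.  The products of powers of [n.+1] functions outnumber the products
   of powers of the [f i], which yields an algebraic relation. *)
Section FiniteExtension.
Variables (k : closedFieldType) (d : nat) (mf : measure d) (J : finType).
Variables (q h : J -> {mpoly k[d]}) (e : J -> nat).
Variables (n : nat) (f : 'I_n -> {mpoly k[d]}) (delta : 'I_n -> nat).
Hypothesis mf_gt0 : forall i, (0 < mf U_(i)%MM)%N.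
Hypothesis q_homog : forall j, q j \is (e j).-homog for mf.
Hypothesis q_top : forall j, (mmeasure mf (q j - h j) <= e j)%N.
Hypothesis f_homog : forall i, f i \is (delta i).-homog for mf.
Hypothesis delta_gt0 : forall i, (0 < delta i)%N.
Hypothesis zero_qf : forall u, (forall j, (q j).@[u] = 0) ->
  (forall i, (f i).@[u] = 0) -> forall i, u i = 0.

Let V (u : 'I_d -> k) : Prop := forall j, (h j).@[u] = 0.

(** The bound [D], fixed once for all, expresses finiteness over the polynomials in the [f i]; the
    bound [N] on the degrees of the coefficients serves the counting of equations. *)
Definition spanned (D N : nat) (p : {mpoly k[d]}) : Prop :=
  exists2 b : 'X_{1..d < D.+1} -> {mpoly k[n]}, forall m, (msize (b m) <= N.+1)%N &
    forall u, V u -> p.@[u] = \sum_m (b m).@[fun i => (f i).@[u]] * 'X_[m].@[u].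

Lemma spanned_eq D N p p' : (forall u, V u -> p.@[u] = p'.@[u]) ->
  spanned D N p -> spanned D N p'.
Proof. by move=> eqp [b sb bP]; exists b => // u Vu; rewrite -eqp // bP. Qed.

Lemma spanned_le D N N' p : (N <= N')%N -> spanned D N p -> spanned D N' p.
Proof.
by move=> le [b sb bP]; exists b => // m; apply: leq_trans (sb m) _.
Qed.

Lemma spanned0 D N : spanned D N 0.
Proof.
exists (fun=> 0) => [m|u _]; first by rewrite mmeasure0.
by rewrite meval0 big1 // => m _; rewrite meval0 mul0r.
Qed.

Lemma spannedD D N p p' : spanned D N p -> spanned D N p' -> spanned D N (p + p').
Proof.
case=> b sb bP [b' sb' bP']; exists (fun m => b m + b' m) => [m|u Vu].
  by apply: leq_trans (mmeasureD_le _ _ _) _; rewrite geq_max sb sb'.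
rewrite mevalD bP // bP' // -big_split; apply: eq_bigr => m _ /=.
by rewrite mevalD mulrDl.
Qed.

Lemma spannedZ D N c p : spanned D N p -> spanned D N (c *: p).
Proof.
case=> b sb bP; exists (fun m => c *: b m) => [m|u Vu].
  by apply: leq_trans (mmeasureZ_le _ _ _) (sb m).
rewrite mevalZ bP // mulr_sumr; apply: eq_bigr => m _ /=.
by rewrite mevalZ mulrA.
Qed.

Lemma spanned_sum D N (T : eqType) (r : seq T) (F : T -> {mpoly k[d]}) :
  (forall t, t \in r -> spanned D N (F t)) -> spanned D N (\sum_(t <- r) F t).
Proof.
move=> rF; rewrite big_seq; apply: (big_ind (spanned D N)) => //.
- exact: spanned0.
- by move=> *; apply: spannedD.
Qed.

Lemma spannedM D N i p : spanned D N p -> spanned D N.+1 (p * f i).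
Proof.
case=> b sb bP; exists (fun m => b m * 'X_i) => [m|u Vu].
  rewrite -[in X in (_ <= X)%N]addn1.
  by apply: mmeasureM_leS (sb m) _; rewrite mmeasureX /= mdeg1.
rewrite mevalM bP // mulr_suml; apply: eq_bigr => m _ /=.
by rewrite mevalM mevalXU mulrAC.
Qed.

Lemma spanned_small D m : (mdeg m <= D)%N -> spanned D 0 'X_[m].
Proof.
move=> lem; have ltm : (mdeg m < D.+1)%N by [].
exists (fun m' => (m' == BMultinom ltm)%:R) => [m'|u _].
  by case: eqP => _; rewrite ?mmeasure1 ?mmeasure0.
rewrite (bigD1 (BMultinom ltm)) //= eqxx meval1 mul1r big1 ?addr0 //.
by move=> m' /negPf->; rewrite meval0 mul0r.
Qed.

(** [D] comes from the graded Nullstellensatz for the [q j] and [f i] together. A monomial of weight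
    at least [D] is a combination of these; on [V] each [q j] may be replaced by [q j - h j], which
    lowers the weight, and the cofactors of the [f i] have lower weight since [delta i] is
    positive. *)
Lemma exists_spanned : exists D, forall N p, (mmeasure mf p <= N)%N -> spanned D N p.
Proof.
pose G (x : J + 'I_n) := match x with inl j => q j | inr i => f i end.
pose eG (x : J + 'I_n) := match x with inl j => e j | inr i => delta i end.
have G_homog x : G x \is (eG x).-homog for mf by case: x.
have [|D DP] := graded_nullstellensatz mf_gt0 G_homog.
  by move=> u u0; apply: zero_qf => [j|i]; [apply: (u0 (inl j)) | apply: (u0 (inr i))].
exists D; elim=> [|N ih] p; first by move=> /mmeasure_le0->; apply: spanned0.
move=> /mmeasure_leP hp; rewrite [p]mpolyE; apply: spanned_sum => m /hp mN.
apply: spannedZ; move: mN; rewrite ltnS leq_eqVlt => /orP[/eqP eqN|ltN]; last first.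
  by apply: (spanned_le (leqnSn N)); apply: ih; rewrite mmeasureX.
case: (leqP D (mf m)) => [le_D|lt_D]; last first.
  apply: (spanned_le (leq0n _)); apply: spanned_small; apply: leq_trans (ltnW lt_D).
  rewrite mdegE mfE; apply: leq_sum => i _; exact: leq_pmulr.
have [a eqX aP] := idspan_pihomog G_homog (mf m) (DP m le_D).
rewrite -[X in spanned _ _ X](pihomog_dE (mf := mf) (d := mf m)) ?dhomogX //= eqX.
rewrite big_sumType /=; apply: spannedD.
  apply: (spanned_eq (p := \sum_j a (inl j) * (q j - h j))) => [u Vu|].
    rewrite !raddf_sum; apply: eq_bigr => j _ /=.
    by rewrite !mevalM mevalB Vu subr0.
  apply: spanned_sum => j _; apply: (spanned_le (leqnSn N)); apply: ih.
  case: (aP (inl j)) => [[le_e ah]|->]; last by rewrite mul0r mmeasure0.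
  apply: leq_trans (mmeasure_homogM ah (q_top j)) _.
  by rewrite /= subnK // eqN.
apply: spanned_sum => i _; apply: spannedM; apply: ih.
case: (aP (inr i)) => [[le_e ah]|->]; last by rewrite mmeasure0.
apply: leq_trans (mmeasure_homog ah) _; rewrite eqN /= ltn_subrL delta_gt0.
by rewrite -eqN (leq_trans (delta_gt0 i)).
Qed.

Theorem alg_dependent_zero_locus : alg_dependent n.+1 (fun u => V u).
Proof.
move=> g; have [D DP] := exists_spanned.
pose c := (\max_i mmeasure mf (g i))%N.
have [N N_gt0 ltN] := counting_bound #|{: 'X_{1..d < D.+1}}| c n.
(* Bounds the measure of every product of powers with exponents below [N]. *)
pose B := (c * (n.+1 * N)).+1.
pose power (al : {ffun 'I_n.+1 -> 'I_N}) := \prod_i g i ^+ al i.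
have power_measure al : (mmeasure mf (power al) <= B)%N.
  have pX i s : (mmeasure mf (g i ^+ s) <= (c * s).+1)%N.
    elim: s => [|s ih]; first by rewrite expr0 mmeasure1.
    rewrite exprS mulnS; apply: mmeasureM_leS => //.
    by apply: leqW; apply: (leq_bigmax (F := fun i => mmeasure mf (g i))).
  have: (mmeasure mf (power al) <= (c * \sum_i al i).+1)%N.
    rewrite /power; apply: (big_rec2 (fun p s => mmeasure mf p <= (c * s).+1)%N).
      by rewrite mmeasure1.
    by move=> i s p _ ih; rewrite mulnDr; apply: mmeasureM_leS.
  move/leq_trans; apply; rewrite ltnS leq_mul2l; apply/orP; right.
  rewrite -[X in (_ <= X * _)%N]card_ord -sum_nat_const; apply: leq_sum => i _.
  exact: ltnW.
have exb al : exists b : 'X_{1..d < D.+1} -> {mpoly k[n]},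
    (forall m, (msize (b m) <= B.+1)%N) /\ forall u, V u ->
    (power al).@[u] = \sum_m (b m).@[fun i => (f i).@[u]] * 'X_[m].@[u].
  by have [b bs bP] := DP B _ (power_measure al); exists b.
have {exb} [b bP] := choice_fun exb.
have bs al m := (bP al).1 m; have {}bP al := (bP al).2.
(* The unknowns are indexed by the [N ^ n.+1] exponent vectors. The equations, one for each pair of
   a spanning monomial and a monomial in the [f i], are fewer by the choice of [N]. *)
have [|x [al0 x0] xP] := @exists_linear_relation k {ffun 'I_n.+1 -> 'I_N}
  ('X_{1..d < D.+1} * 'X_{1..n < B.+1})%type (fun al t => (b al t.1)@_t.2).
  rewrite card_prod card_ffun !card_ord.
  apply: leq_ltn_trans ltN; rewrite leq_mul2l; apply/orP; right.
  exact: card_bmultinom_le.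
pose mon (al : {ffun 'I_n.+1 -> 'I_N}) := [multinom (al i : nat) | i < n.+1].
have mon_inj : injective mon.
  move=> al be /mnmP eqm; apply/ffunP => i; apply/val_inj.
  by have := eqm i; rewrite !mnmE.
exists (\sum_al x al *: 'X_[mon al]).
  apply: contraNneq x0 => F0; have := congr1 (mcoeff (mon al0)) F0.
  rewrite mcoeff0 raddf_sum (bigD1 al0) //= mcoeffZ mcoeffX eqxx mulr1 big1 ?addr0.
    by move=> ->.
  by move=> al ne; rewrite mcoeffZ mcoeffX inj_eq // (negPf ne) mulr0.
move=> u Vu; rewrite raddf_sum /=.
have term al : (x al *: 'X_[mon al]).@[fun i => (g i).@[u]] =
    \sum_m \sum_(t : 'X_{1..n < B.+1}) x al * (b al m)@_t *
       ('X_[t].@[fun i => (f i).@[u]] * 'X_[m].@[u]).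
  rewrite mevalZ mevalX.
  have -> : \prod_i (g i).@[u] ^+ mon al i = (power al).@[u].
    rewrite rmorph_prod; apply: eq_bigr => i _ /=.
    by rewrite rmorphXn /= mnmE.
  rewrite bP // mulr_sumr; apply: eq_bigr => m _.
  rewrite {1}[b al m](mpolywE (bs al m)) raddf_sum mulr_suml mulr_sumr.
  by apply: eq_bigr => t _; rewrite /= mevalZ !mulrA.
under eq_bigr do rewrite term.
rewrite exchange_big /= big1 // => m _; rewrite exchange_big /= big1 // => t _.
by rewrite -mulr_suml (xP (m, t)) mul0r.
Qed.
End FiniteExtension.

(** * Chains of irreducible closed sets *)

Section ZariskiSets.
Variables (k : closedFieldType) (d : nat).
Local Notation A := ({ffun 'I_d -> k}).
Implicit Types (Y Z W : A -> Prop) (u : A).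

Definition vanishes Z (p : {mpoly k[d]}) : Prop := forall u, Z u -> p.@[u] = 0.

Lemma vanishes_ideal Z : is_ideal (vanishes Z).
Proof.
split=> [u _|p q hp hq u Zu|a p hp u Zu]; first by rewrite meval0.
  by rewrite mevalD hp ?hq ?addr0.
by rewrite mevalM hp ?mulr0.
Qed.

Lemma closed_in_sub Y Z : closed_in Y Z -> included Z Y.
Proof. by case=> C _ ZP u /ZP[]. Qed.

Lemma closed_in_vanishes Y Z Z' : closed_in Y Z' -> included Z Y ->
  (forall p, vanishes Z' p -> vanishes Z p) -> included Z Z'.
Proof.
case=> C [S CS] Z'P sZY van u Zu; apply/Z'P; split; first exact: sZY.
by apply/CS => p Sp; apply: van (u) Zu => u' /Z'P[_ /CS]; apply.
Qed.

Lemma zariski_closedI (C D : A -> Prop) : zariski_closed C -> zariski_closed D ->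
  zariski_closed (fun u => C u /\ D u).
Proof.
case=> S CS [T DT]; exists (fun p => S p \/ T p) => u; split.
  by case=> /CS Cu /DT Du p [/Cu|/Du].
by move=> h; split; [apply/CS | apply/DT] => p Sp; apply: h; [left | right].
Qed.

Lemma zariski_closed_poly (p : {mpoly k[d]}) : zariski_closed (fun u : A => p.@[u] = 0).
Proof. by exists (eq p) => u; split=> [pu _ <-//|]; apply. Qed.

Lemma zariski_closed_locus (E : seq {mpoly k[d]}) : zariski_closed (zero_locus E).
Proof. by exists (fun p => p \in E). Qed.

Lemma closed_inI Y Z Z' : closed_in Y Z -> closed_in Y Z' ->
  closed_in Y (fun u => Z u /\ Z' u).
Proof.
case=> C cC ZP [C' cC' ZP']; exists (fun u => C u /\ C' u).
  exact: zariski_closedI.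
move=> u; split=> [[/ZP[Yu Cu] /ZP'[_ C'u]]|[Yu [Cu C'u]]] //.
by split; [apply/ZP | apply/ZP'].
Qed.

(** The zero loci of [p] and [q] in [Y] are closed and cover [Z], so one of them contains [Z]. *)
Lemma irreducible_prime Y Z p q : irreducible_closed (closed_in Y) Z ->
  vanishes Z (p * q) -> vanishes Z p \/ vanishes Z q.
Proof.
case=> clZ _ irr van.
have cl r : closed_in Y (fun u => Y u /\ r.@[u] = 0).
  by exists (fun u : A => r.@[u] = 0) => //; exact: zariski_closed_poly.
have [|sZ|sZ] := irr _ _ (cl p) (cl q).
- move=> u Zu; have Yu := closed_in_sub clZ Zu.
  have /eqP := van u Zu; rewrite mevalM mulf_eq0 => /orP[/eqP|/eqP] h; first by left.
  by right.
- by left=> u /sZ[].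
by right=> u /sZ[].
Qed.

Lemma alg_dependent_sub r Z Z' : included Z Z' ->
  alg_dependent r Z' -> alg_dependent r Z.
Proof.
by move=> sZ dep g; have [F F0 hF] := dep g; exists F => // u /sZ /hF.
Qed.

Lemma alg_dependent0 Z u : Z u -> ~ alg_dependent 0 Z.
Proof.
move=> Zu /(_ (fun=> 0)) [F F0 /(_ u Zu)].
rewrite -[F](mpolyKC F) mevalC => F00; case/eqP: F0.
by rewrite -[F](mpolyKC F) F00 mpolyC0.
Qed.

(* A relation of minimal degree in the last variable, evaluated at a function
   vanishing on [Z'] but not on [Z], has a nonzero constant term. *)
Lemma alg_dependent_proper Y r Z Z' : irreducible_closed (closed_in Y) Z ->
  closed_in Y Z' -> included Z' Z -> ~ included Z Z' ->
  alg_dependent r.+1 Z -> alg_dependent r Z'.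
Proof.
move=> irrZ clZ' sZ'Z nsZZ' dep g; have [clZ _ _] := irrZ.
have [f [f0 fn0]] : exists f, vanishes Z' f /\ ~ vanishes Z f.
  apply: NNPP => nf; apply: nsZZ'; apply: (closed_in_vanishes clZ').
    exact: closed_in_sub clZ.
  by move=> p p0; apply: NNPP => np; apply: nf; exists p.
pose g' i := oapp g f (unlift ord_max i).
have g'max : g' ord_max = f by rewrite /g' unlift_none.
pose ev (q : {poly {mpoly k[r]}}) (u : A) :=
  (map_poly (meval (fun i => (g i).@[u])) q).[f.@[u]].
have evE q u : (join_last q).@[fun i => (g' i).@[u]] = ev q u.
  rewrite meval_join_last g'max; congr (_.[_]); apply: eq_map_poly => p.
  apply: meval_eq => i; congr meval.
  by rewrite /g' widen_ord_lift liftK.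
have [|q [q0 hq] minq] := @exists_minimal {poly {mpoly k[r]}}
    (fun q => q != 0 /\ forall u, Z u -> ev q u = 0) (fun q => size q).
  have [F F0 hF] := dep g'; have [q eqF] := join_last_surj F.
  exists q; split=> [|u Zu]; last by rewrite -evE eqF hF.
  by apply: contraNneq F0 => q0; rewrite -eqF q0 rmorph0.
have [q1 [c eqq]] : exists q1 c, q = q1 * 'X + c%:P.
  by elim/poly_ind: (q) => [|q1 c _]; [exists 0, 0; rewrite mul0r addr0 | exists q1, c].
have evq u : ev q u = ev q1 u * f.@[u] + c.@[fun i => (g i).@[u]].
  by rewrite /ev eqq rmorphD rmorphM /= map_polyX map_polyC hornerMXaddC.
have [c0|cn0] := eqVneq c 0; last first.
  exists c => // u Z'u; have := hq u (sZ'Z u Z'u).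
  by rewrite evq f0 // mulr0 add0r.
have q1n0 : q1 != 0.
  by apply: contraNneq q0 => q10; rewrite eqq q10 c0 mul0r addr0.
(* If the constant term [c] is 0, then [q1] times [f] vanishes on [Z] while [f] does not, so [q1] is
   a shorter relation. *)
have [|van|//] := @irreducible_prime Y Z (join_last q1 \mPo [tuple g' i | i < r.+1]) f irrZ.
  move=> u Zu; rewrite mevalM comp_mpoly_meval.
  rewrite (meval_eq (v2 := fun i => (g' i).@[u])); last by move=> i; rewrite tnth_mktuple.
  by rewrite evE; have := hq u Zu; rewrite evq c0 meval0 addr0.
suff: (size q <= size q1)%N by rewrite eqq c0 addr0 size_mulX // ltnn.
apply: minq; split=> // u Zu.
rewrite -evE -(van u Zu) comp_mpoly_meval.
by apply: meval_eq => i; rewrite tnth_mktuple.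
Qed.

(** Going down from the largest member, each strict inclusion lowers [r] by one; the smallest member
    is nonempty, so [r] is still positive there. *)
Lemma alg_dependent_chain Y r n c : alg_dependent r Y ->
  irreducible_chain (closed_in Y) n c -> (n <= r)%N.
Proof.
case: n => // n dep ch; have [irr _] := ch.
have [clc _ _] := irr n (ltnSn n).
have := alg_dependent_sub (closed_in_sub clc) dep.
elim: n r {dep clc} ch irr => [|n ih] r ch irr dep.
  have [_ [u cu] _] := irr 0%N (ltnSn 0).
  by case: r dep => // /(alg_dependent0 cu).
have [_ [u cu] _] := irr n.+1 (ltnSn n.+1).
case: r dep => [/(alg_dependent0 cu)//|r dep].
have [_ /(_ n (ltnSn n.+1)) [sc nsc]] := ch.
have [clc _ _] := irr n (leqnSn n.+1).
apply: ih; [|by move=> i lti; apply/irr/leqW|].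
  by split=> i lti; [apply/ch.1/leqW | apply/ch.2/leqW].
exact: alg_dependent_proper (irr n.+1 (ltnSn n.+1)) clc sc nsc dep.
Qed.
End ZariskiSets.

Lemma bounded_has_dim (T : Type) (closed : (T -> Prop) -> Prop) B :
  (forall m c, irreducible_chain closed m c -> (m <= B)%N) ->
  exists n, has_dim closed (n%:Z - 1) /\ (exists c, irreducible_chain closed n c) /\
    forall m c, irreducible_chain closed m c -> (m <= n)%N.
Proof.
move=> hB.
suff [n nc maxn] : exists2 n, (exists c, irreducible_chain closed n c) &
    forall m c, irreducible_chain closed m c -> (m <= n)%N.
  by exists n; split=> //; exists n.
have [|m [lem [c mc]] minm] := @exists_minimal nat
    (fun m => (m <= B)%N /\ exists c, irreducible_chain closed m c) (fun m => B - m)%N.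
  (* The empty chain shows that some length occurs. *)
  by exists 0%N; split=> //; exists (fun _ _ => True); split.
exists m => [|m' c' mc']; first by exists c.
have lem' := hB _ _ mc'.
have := minm m' (conj lem' (ex_intro _ c' mc')).
by rewrite leq_sub2lE.
Qed.

(** * Weighted cones *)

Section WeightedCones.
Variables (k : closedFieldType) (d : nat) (v : 'I_d -> nat).
Hypothesis v_gt0 : forall i, (0 < v i)%N.
Local Notation A := ({ffun 'I_d -> k}).
Local Notation origin := ([ffun=> 0] : A).
Implicit Types (Y Z W : A -> Prop) (u : A).

Lemma gm_act1 u : gm_act v 1 u = u.
Proof. by apply/ffunP => i; rewrite ffunE expr1n mul1r. Qed.

Lemma gm_actM c c' u : gm_act v c (gm_act v c' u) = gm_act v (c * c') u.
Proof. by apply/ffunP => i; rewrite !ffunE exprMn mulrA. Qed.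

Lemma gm_act_eq0 c u : c != 0 -> gm_act v c u = origin -> u = origin.
Proof.
move=> c0 /ffunP h; apply/ffunP => i; have := h i; rewrite !ffunE => /eqP.
by rewrite mulf_eq0 (negPf (expf_neq0 _ c0)) => /eqP.
Qed.

Lemma gm_act0 u : gm_act v 0 u = origin.
Proof. by apply/ffunP => i; rewrite !ffunE expr0n (gtn_eqF (v_gt0 i)) mul0r. Qed.

(** The pullback of [p] along the orbit map of [u], as a polynomial in the scalar; having natural
    weights, it can also be evaluated at the scalar 0. *)
Definition orbit_poly (p : {mpoly k[d]}) u : {poly k} :=
  mmap (@polyC k) (fun i => 'X^(v i) * (u i)%:P) p.

Lemma orbit_polyE p u c : (orbit_poly p u).[c] = p.@[gm_act v c u].
Proof.
rewrite /orbit_poly; elim/mpolyind: p => [|a m p _ _ ih].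
  by rewrite mmap0 meval0 horner0.
rewrite mmapD hornerD ih mevalD; congr (_ + _).
rewrite mmapZ mmapX hornerM hornerC mevalZ mevalX; congr (_ * _).
rewrite /mmap1 horner_prod; apply: eq_bigr => i _.
by rewrite horner_exp hornerM hornerXn hornerC ffunE.
Qed.

Lemma nonzero_nonroot (p : {poly k}) : p != 0 -> exists2 c, c != 0 & p.[c] != 0.
Proof.
move=> p0; have /closed_nonrootP[c] : p * 'X != 0 by rewrite mulf_neq0 ?polyX_eq0.
by rewrite rootE hornerMX mulf_eq0 => /norP[pc c0]; exists c.
Qed.

Lemma orbit_poly_eq0 p u : (forall c, c != 0 -> p.@[gm_act v c u] = 0) ->
  orbit_poly p u = 0.
Proof.
move=> h; apply: NNPP => /eqP /nonzero_nonroot[c c0].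
by rewrite orbit_polyE h ?eqxx.
Qed.

(** An equation of [C] pulls back to a polynomial vanishing at all nonzero scalars, hence to 0; its
    value at the scalar 0 is the value at the origin, the weights being positive. *)
Lemma origin_in_closed C u : zariski_closed C ->
  (forall c, c != 0 -> C (gm_act v c u)) -> C origin.
Proof.
case=> S CS h; apply/CS => p Sp; rewrite -(gm_act0 u) -orbit_polyE.
by rewrite orbit_poly_eq0 ?horner0 // => c /h /CS; apply.
Qed.

Lemma proj_closed_in_Y Y Z : proj_closed_in v Y Z -> included Z Y.
Proof. by case=> _ [C _ ZP] u /ZP[[]]. Qed.

Lemma proj_closed_in_neq0 Y Z u : proj_closed_in v Y Z -> Z u -> u <> origin.
Proof. by case=> _ [C _ ZP] /ZP[[]]. Qed.

Lemma punctured_closed Y : gm_stable v Y ->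
  proj_closed_in v Y (fun u => Y u /\ u <> origin).
Proof.
move=> sY; split=> [c u c0 [Yu nu]|].
  by split; [apply: sY | move=> /(gm_act_eq0 c0)].
exists (fun=> True); last by move=> u; split=> [|[]].
by exists (fun=> False).
Qed.

Lemma proj_closed_inI Y Z Z' : proj_closed_in v Y Z -> proj_closed_in v Y Z' ->
  proj_closed_in v Y (fun u => Z u /\ Z' u).
Proof.
case=> sZ cZ [sZ' cZ']; split; last exact: closed_inI.
by move=> c u c0 [/(sZ _ _ c0) ? /(sZ' _ _ c0) ?].
Qed.

Lemma irreducible_proj_sub Y Y' W : zariski_closed Y' -> gm_stable v Y' ->
  included Y' Y -> irreducible_closed (proj_closed_in v Y') W ->
  irreducible_closed (proj_closed_in v Y) W.
Proof.
move=> cY' sY' sub [[sW [C cC WP]] nW irrW]; split=> //.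
  split=> //; exists (fun u => Y' u /\ C u); first exact: zariski_closedI.
  move=> u; rewrite WP; split=> [[[/[dup] /sub ? ?] ?]|[[? ?] [? ?]]] //.
have WY' u : W u -> Y' u by move=> /WP[[]].
have res (B : A -> Prop) : proj_closed_in v Y B ->
    proj_closed_in v Y' (fun u => Y' u /\ B u).
  case=> sB [E cE BP]; split.
    by move=> c u c0 [/(sY' _ _ c0) ? /(sB _ _ c0) ?].
  exists E => // u; rewrite BP; split=> [[? [[? ?] ?]]|[[? ?] ?]] //.
  by split=> //; split=> //; split=> //; apply: sub.
move=> B D /res cB /res cD cov; have [|h|h] := irrW _ _ cB cD.
- by move=> u Wu; case: (cov u Wu) => h; [left | right]; split=> //; apply: WY'.
- by left=> u /h[].
by right=> u /h[].
Qed.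

(** Stands for finitely many points with at least one on each irreducible component of [Z], but
    phrased with larger irreducible sets instead of components. *)
Definition has_component_points Y Z : Prop :=
  exists pts : seq A, (forall p, p \in pts -> Z p) /\
  forall W, irreducible_closed (proj_closed_in v Y) W -> included W Z ->
    exists W' p, [/\ irreducible_closed (proj_closed_in v Y) W',
      included W W', p \in pts & W' p].

(** Noetherian induction: a counterexample with maximal vanishing ideal is nonempty and reducible,
    and the points of its two smaller pieces together serve for it. *)
Lemma component_points Y Z : proj_closed_in v Y Z ->
  has_component_points Y Z /\ ((exists u, Z u) ->
    exists W, irreducible_closed (proj_closed_in v Y) W).
Proof.
pose good Z := has_component_points Y Z /\ ((exists u, Z u) ->
    exists W, irreducible_closed (proj_closed_in v Y) W).
move=> clZ0; apply: NNPP => nZ0.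
pose Phi (I : {mpoly k[d]} -> Prop) := exists2 Z, proj_closed_in v Y Z /\ ~ good Z &
  forall p, I p <-> vanishes Z p.
have [I [{Z clZ0 nZ0} Z [clZ badZ] IZ] maxI] : exists2 I, Phi I &
    forall J, Phi J -> (forall x, I x -> J x) -> forall x, J x -> I x.
  apply: (noetherian_maximal (I0 := vanishes Z) (@noetherian_mpoly k d)).
    move=> I [Z' _ IZ]; have [I0 ID IM] := vanishes_ideal Z'.
    by split=> [|x y /IZ hx /IZ hy|a x /IZ hx]; apply/IZ => //; [exact: ID | exact: IM].
  by exists Z.
have smaller Z' : proj_closed_in v Y Z' -> included Z' Z -> ~ included Z Z' -> good Z'.
  move=> clZ' sZ' nsZ'; apply: NNPP => badZ'; apply: nsZ'.
  apply: closed_in_vanishes (clZ'.2) _ _.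
    by move=> u Zu; split; [exact: (proj_closed_in_Y clZ) | exact: proj_closed_in_neq0 clZ _].
  move=> p p0; apply/IZ; apply: (maxI (vanishes Z')) => //; first by exists Z'.
  by move=> x /IZ x0 u /sZ' /x0.
apply: badZ.
case: (classic (exists u, Z u)) => [[u0 Zu0]|Z0]; last first.
  split=> //; exists [::]; split=> // W [_ [u Wu] _] sWZ.
  by case: Z0; exists u; apply: sWZ.
case: (classic (irreducible_closed (proj_closed_in v Y) Z)) => [irrZ|nirr].
  split; last by exists Z.
  exists [:: u0]; split=> [p|W irrW sWZ]; first by rewrite inE => /eqP->.
  by exists Z, u0; split=> //; rewrite mem_head.
have [B [D [clB clD cov [nB nD]]]] : exists B D, [/\ proj_closed_in v Y B,
    proj_closed_in v Y D, included Z (fun x => B x \/ D x) &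
    ~ included Z B /\ ~ included Z D].
  apply: NNPP => h; apply: nirr; split=> //; first by exists u0.
  move=> B D clB clD cov; apply: NNPP => /not_or_and[nB nD].
  by apply: h; exists B, D.
have [[ptsB [pB hB]] exB] : good (fun u => Z u /\ B u).
  apply: smaller; [exact: proj_closed_inI | by move=> u [] |].
  by move=> h; apply: nB => u /h[].
have [[ptsD [pD hD]] exD] : good (fun u => Z u /\ D u).
  apply: smaller; [exact: proj_closed_inI | by move=> u [] |].
  by move=> h; apply: nD => u /h[].
split; last first.
  by move=> _; case: (cov u0 Zu0) => h; [apply: exB | apply: exD]; exists u0.
exists (ptsB ++ ptsD); split=> [p|W irrW sWZ].
  by rewrite mem_cat => /orP[/pB[]|/pD[]].
have [_ _ /(_ B D clB clD) irr] := irrW.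
have [u /sWZ /cov//|h|h] := irr.
  have [|W' [p [irrW' sW' pp W'p]]] := hB W irrW; first by move=> u Wu; split; auto.
  by exists W', p; split=> //; rewrite mem_cat pp.
have [|W' [p [irrW' sW' pp W'p]]] := hD W irrW; first by move=> u Wu; split; auto.
by exists W', p; split=> //; rewrite mem_cat pp orbT.
Qed.

Section HomogeneousParameters.
Variables (mf : measure d).
Hypothesis mfU : forall i, mf U_(i)%MM = v i.

Lemma homog_zero_stable e (p : {mpoly k[d]}) : p \is e.-homog for mf ->
  gm_stable v (fun u : A => p.@[u] = 0).
Proof.
move=> hp c u c0 pu; rewrite (meval_eq (v2 := fun i => c ^+ v i * u i)).
  by rewrite (meval_homog u c mfU hp) pu mulr0.
by move=> i; rewrite ffunE.
Qed.

(* A combination of the [X_i ^ (M / v_i)], with [M] a common multiple of the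
   weights and coefficients the powers of a sufficiently general scalar. *)
Lemma exists_nonvanishing_form (pts : seq A) : (forall p, p \in pts -> p <> origin) ->
  exists (f : {mpoly k[d]}) e, [/\ (0 < e)%N, f \is e.-homog for mf &
    forall p, p \in pts -> f.@[p] != 0].
Proof.
move=> pts0; pose M := (\prod_i v i)%N; pose w i := (M %/ v i)%N.
have M_gt0 : (0 < M)%N by rewrite prodn_gt0.
have wM i : (w i * v i)%N = M.
  by rewrite /w divnK // /M (bigD1 i) //= dvdn_mulr.
have w_gt0 i : (0 < w i)%N by have := M_gt0; rewrite -(wM i) muln_gt0 => /andP[].
pose P (p : A) : {poly k} := \sum_i (p i ^+ w i) *: 'X^i.
have P0 p : p \in pts -> P p != 0.
  move=> /pts0 p0; apply/eqP => Pp; apply: p0; apply/ffunP => i; rewrite ffunE.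
  have := congr1 (fun r : {poly k} => r`_i) Pp.
  rewrite coef0 coef_sum (bigD1 i) //= coefZ coefXn eqxx mulr1 big1 ?addr0.
    by move/eqP; rewrite expf_eq0 w_gt0 => /eqP.
  by move=> j ne; rewrite coefZ coefXn eq_sym val_eqE (negPf ne) mulr0.
have /closed_nonrootP[t rt] : \prod_(p <- pts) P p != 0.
  by rewrite prodf_seq_neq0; apply/allP => p /P0.
exists (\sum_(i < d) t ^+ i *: 'X_i ^+ w i), M; split=> // [|p pp].
  apply: rpred_sum => i _; apply: dhomogZ; rewrite mpolyXn dhomogX /=.
  rewrite mfE (bigD1 i) //= mulmnE mnm1E eqxx mul1n mfU wM big1 ?addn0 //.
  by move=> j ne; rewrite mulmnE mnm1E eq_sym (negPf ne).
apply: contra rt => /eqP fp; rewrite rootE horner_prod prodf_seq_eq0.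
apply/hasP; exists p => //=; rewrite -fp horner_sum raddf_sum /=; apply/eqP.
by apply: eq_bigr => i _; rewrite hornerZ hornerXn mevalZ rmorphXn /= mevalXU mulrC.
Qed.

(** Induction on [n]: the first parameter is a form vanishing at none of the component points of
    [Y], and its zero locus [Y'] has shorter chains. *)
Theorem exists_parameters n Y : zariski_closed Y -> gm_stable v Y ->
  (forall m c, irreducible_chain (proj_closed_in v Y) m c -> (m <= n)%N) ->
  exists (f : 'I_n -> {mpoly k[d]}) (e : 'I_n -> nat),
    [/\ forall i, (0 < e i)%N, forall i, f i \is (e i).-homog for mf &
      forall u, Y u -> (forall i, (f i).@[u] = 0) -> u = origin].
Proof.
elim: n Y => [|n ih] Y cY sY chY.
  (* With no chain of one member, the quotient has no irreducible closed subset, so [Y] has no point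
     besides the origin. *)
  exists (fun=> 0), (fun=> 1%N); split=> [//|[]//|u Yu _].
  apply: NNPP => u0.
  have clY := punctured_closed sY.
  have [_ [|W irrW]] := component_points clY; first by exists u.
  suff: irreducible_chain (proj_closed_in v Y) 1 (fun=> W) by move/chY.
  by split=> [i|i] //; rewrite ltnS => ->.
have clY := punctured_closed sY.
have [[pts [ptsY hpts]] _] := component_points clY.
have [|f [e [e0 hf fpts]]] := @exists_nonvanishing_form pts.
  by move=> p /ptsY[].
pose Y' u := Y u /\ f.@[u] = 0.
have cY' : zariski_closed Y'.
  by apply: zariski_closedI => //; exact: zariski_closed_poly.
have sY' : gm_stable v Y'.
  by move=> c u c0 [Yu fu]; split; [apply: sY | apply: (homog_zero_stable hf)].
have sub : included Y' Y by move=> u [].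
have [m c ch|F [E [E0 hF FY']]] := ih Y' cY' sY'.
  case: m ch => // m [irr str].
  have irrY i : (i < m.+1)%N -> irreducible_closed (proj_closed_in v Y) (c i).
    by move=> /irr; apply: irreducible_proj_sub.
  have [clc _ _] := irrY m (ltnSn m).
  have [|W [p [irrW sW pp Wp]]] := hpts (c m) (irrY m (ltnSn m)).
    by move=> u cu; split; [exact: (proj_closed_in_Y clc) | exact: proj_closed_in_neq0 clc _].
  (* A chain in [Y'] is prolonged by the irreducible set [W] containing a component point [p]; the
     inclusion is strict because [f] vanishes on [Y'] but not at [p]. *)
  rewrite -ltnS; apply: (chY _ (fun i => if (i < m.+1)%N then c i else W)).
  split=> i; first by case: ifP => [lt _|//]; apply: irrY.
  rewrite !ltnS => le_im; rewrite le_im; case: ltnP => [lt_im|le_mi].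
    exact: str.
  have -> : i = m by apply/eqP; rewrite eqn_leq le_im.
  split=> // sWc; have [clm' _ _] := irr m (ltnSn m).
  have [_ fp] := proj_closed_in_Y clm' (sWc p Wp).
  by have := fpts p pp; rewrite fp eqxx.
exists (fun i => oapp F f (unlift ord_max i)), (fun i => oapp E e (unlift ord_max i)).
split=> [i|i|u Yu fu]; try by case: unlift.
apply: FY' => [|i]; first by split=> //; have := fu ord_max; rewrite unlift_none.
by have := fu (lift ord_max i); rewrite liftK.
Qed.
End HomogeneousParameters.

(* Adding the vertex to a closed subset of the projective quotient preserves
   irreducibility because the orbits are irreducible. *)
Lemma affine_cone_irreducible Y Z : gm_stable v Y -> Y origin ->
  irreducible_closed (proj_closed_in v Y) Z ->
  irreducible_closed (closed_in Y) (fun u => Z u \/ u = origin).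
Proof.
move=> sY Y0 [[sZ [C [S CS] ZP]] [u0 Zu0] irrZ]; split.
- exists (fun u => C u \/ u = origin).
    (* Multiplying every equation of [C] by each variable adds the origin to its zero set. *)
    exists (fun p => exists2 p0, S p0 & exists i, p = p0 * 'X_i) => u; split.
      case=> [/CS Cu|->] p [p0 Sp0 [i ->]]; rewrite mevalM mevalXU ?ffunE ?mulr0 //.
      by rewrite Cu ?mul0r.
    move=> h; case: (classic (u = origin)) => [|u_n0]; first by right.
    left; apply/CS => p Sp; have [i ui] : exists i, u i != 0.
      apply: NNPP => ui; apply: u_n0; apply/ffunP => i; rewrite ffunE.
      by apply: NNPP => /eqP ui0; apply: ui; exists i.
    have /eqP := h (p * 'X_i) (ex_intro2 _ _ p Sp (ex_intro _ i erefl)).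
    by rewrite mevalM mevalXU mulf_eq0 (negPf ui) orbF => /eqP.
  move=> u; rewrite ZP; split=> [[[[? ?] ?]|->]|[? [?|->]]]; [by split; [|left] |
    by split; [|right] | | by right].
  by case: (classic (u = origin)) => ?; [right | left].
- by exists u0; left.
move=> B D [CB cCB BP] [CD cCD DP] cov.
have [[SB CBS] [SD CDS]] := (cCB, cCD).
have ZY u : Z u -> Y u by move=> /ZP[[]].
(* The points whose whole orbit lies in [E]: the largest stable part of [E] in the punctured [Y]. *)
pose hull (E : A -> Prop) u := (Y u /\ u <> origin) /\ forall c, c != 0 -> E (gm_act v c u).
have hull_closed E : zariski_closed E -> proj_closed_in v Y (hull E).
  case=> T ET; split.
    move=> c u c0 [[Yu un0] Eu]; split.
      by split; [apply: sY | move=> /(gm_act_eq0 c0)].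
    by move=> c' c'0; rewrite gm_actM; apply: Eu; rewrite mulf_neq0.
  exists (fun u => forall c, c != 0 -> E (gm_act v c u)) => //.
  exists (fun p => exists2 p0, T p0 & exists2 c, c != 0 &
    p = p0 \mPo [tuple c ^+ v i *: 'X_i | i < d]) => u.
  have ev c p0 : (p0 \mPo [tuple c ^+ v i *: 'X_i | i < d]).@[u] = p0.@[gm_act v c u].
    rewrite comp_mpoly_meval; apply: meval_eq => i.
    by rewrite tnth_mktuple mevalZ mevalXU ffunE.
  split=> [h p [p0 Tp0 [c c0 ->]]|h c c0].
    by rewrite ev; have /ET := h c c0; apply.
  by apply/ET => p0 Tp0; rewrite -ev; apply: h; exists p0 => //; exists c.
have cov' : included Z (fun u => hull CB u \/ hull CD u).
  move=> u Zu; have [Yu un0] : Y u /\ u <> origin by have /ZP[] := Zu.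
  apply: NNPP => /not_or_and[nB nD].
  have wit E T : (forall u, E u <-> (forall p, T p -> p.@[u] = 0)) -> ~ hull E u ->
      exists2 p, T p & orbit_poly p u != 0.
    move=> ET nh; apply: NNPP => np; apply: nh; split=> // c c0; apply/ET => p Tp.
    rewrite -orbit_polyE (_ : orbit_poly p u = 0) ?horner0 //.
    by apply: NNPP => /eqP pn0; apply: np; exists p.
  have [p Bp pn0] := wit _ _ CBS nB; have [r Dr rn0] := wit _ _ CDS nD.
  (* At a scalar where both pullbacks are nonzero, the orbit of [u] leaves [CB] and [CD] at once,
     against the covering. *)
  have [c c0] := nonzero_nonroot (mulf_neq0 pn0 rn0).
  rewrite hornerM !orbit_polyE => /eqP h; apply: h.
  case: (cov (gm_act v c u)); first by left; apply: sZ.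
    by move=> /BP[_ /CBS/(_ p Bp) ->]; rewrite mul0r.
  by move=> /DP[_ /CDS/(_ r Dr) ->]; rewrite mulr0.
have add0 E E' : zariski_closed E -> (forall u, E' u <-> Y u /\ E u) ->
    included Z (hull E) -> included (fun u => Z u \/ u = origin) E'.
  move=> cE E'P sZE u [/[dup] Zu /sZE[[Yu _] Eu]|->]; apply/E'P; split=> //.
    by have := Eu 1 (oner_neq0 _); rewrite gm_act1.
  by apply: (origin_in_closed (u := u0)) => //; case: (sZE u0 Zu0).
have [|h|h] := irrZ _ _ (hull_closed _ cCB) (hull_closed _ cCD) => //.
  by left; apply: add0 h.
by right; apply: add0 h.
Qed.

(** The origin alone is the new smallest member, below the cones over the given members. *)
Lemma affine_cone_chain Y n c : gm_stable v Y -> Y origin ->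
  irreducible_chain (proj_closed_in v Y) n c ->
  exists c', irreducible_chain (closed_in Y) n.+1 c'.
Proof.
move=> sY Y0 [irr str].
exists (fun i u => (if i is j.+1 then c j u else False) \/ u = origin); split.
  case=> [_|i lti]; last by apply: affine_cone_irreducible => //; apply: irr.
  split; last 1 first.
  - move=> B D _ _ cov; case: (cov origin); first (by right); [left|right];
    by move=> u [//|->].
  - exists (fun u => u = origin).
      exists (fun p => exists i, p = 'X_i) => u; split=> [-> p [i ->]|h].
        by rewrite mevalXU ffunE.
      by apply/ffunP => i; rewrite -[u i](mevalXU u i) h ?ffunE //; exists i.
    by move=> u; split=> [[//|->]|[_ ->]]; [split | right].
  by exists origin; right.
have cn0 i u : (i < n)%N -> c i u -> u <> origin.
  by move=> /irr[cl _ _]; exact: proj_closed_in_neq0 cl.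
case=> [lt|i lti].
  split=> [u [//|->]|h]; first by right.
  have [_ [u cu] _] := irr 0%N lt.
  by case: (h u (or_introl cu)) => //; exact: cn0 cu.
have [sc nsc] := str i lti; split=> [u [/sc|->]|h]; [by left | by right |].
apply: nsc => u cu; case: (h u (or_introl cu)) => // u0.
by case: (cn0 i.+1 u lti cu u0).
Qed.
End WeightedCones.

(** * The quadratic approximation of a quasi-cone *)

Lemma meval_origin (R : comNzRingType) d (p : {mpoly R[d]}) :
  p.@[fun=> 0] = p@_0%MM.
Proof.
elim/mpolyind: p => [|c m p _ _ ih]; first by rewrite meval0 mcoeff0.
rewrite mevalD mcoeffD ih mevalZ mcoeffZ mevalX mcoeffX; congr (_ * _ + _).
rewrite prodrXr -mdegE -mdeg_eq0.
by case: (mdeg m) => [|e]; rewrite ?expr0 // exprS mul0r.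
Qed.

(** The case of an empty family of equations, with the coordinates as parameters. *)
Lemma alg_dependent_all (k : closedFieldType) d (Z : {ffun 'I_d -> k} -> Prop) :
  alg_dependent d.+1 Z.
Proof.
apply: alg_dependent_sub (_ : included Z (fun u => forall j : 'I_0, (0 : {mpoly k[d]}).@[u] = 0)) _.
  by move=> u _ [].
apply: (alg_dependent_zero_locus (k := k) (mf := mdeg) (J := 'I_0) (q := fun=> 0)
  (h := fun=> 0) (e := fun=> 0%N) (f := fun i => 'X_i) (delta := fun=> 1%N)) => //.
- by move=> i; rewrite /= mdeg1.
- by case.
- by case.
- by move=> i; rewrite dhomogX /= mdeg1.
by move=> u _ u0 i; rewrite -[RHS](u0 i) mevalXU.
Qed.

(* With respect to the weights [2 w - 1], the quadratic part of a polynomial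
   quasi-homogeneous for [w] and without terms of degree less than 2 is its top
   component, so that parameters for the quadratic cone are parameters for the
   quasi-cone as well. *)
Section QuadraticApproximation.
Variables (k : closedFieldType) (d : nat) (mf mf' : measure d) (v : 'I_d -> nat).
Variable (hs : seq {mpoly k[d]}).
Hypothesis mfU : forall i, mf U_(i)%MM = v i.
Hypothesis v_gt0 : forall i, (0 < v i)%N.
Hypothesis mf'E : forall m, (mf' m + mdeg m = 2 * mf m)%N.
Hypothesis hs_homog : forall h, h \in hs -> exists e, h \is e.-homog for mf.
Hypothesis hs_order : forall h, h \in hs -> forall m, (mdeg m < 2)%N -> h@_m = 0.

Let qs := [seq pihomog mdeg 2 h | h <- hs].
Let X := zero_locus hs.
Let Q := zero_locus qs.
Let v' i := mf' U_(i)%MM.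

Let v'_gt0 i : (0 < v' i)%N.
Proof.
have := mf'E U_(i)%MM; rewrite mdeg1 mfU -/(v' i) => eqv.
have := v_gt0 i; rewrite -(ltn_pmul2l (isT : (0 < 2)%N)) -eqv muln0 addn1.
case: (v' i) eqv => // eqv; have := congr1 odd eqv.
by rewrite oddM.
Qed.

Let msupp_pihomog2 (h : {mpoly k[d]}) m :
  m \in msupp (pihomog mdeg 2 h) -> m \in msupp h /\ mdeg m = 2%N.
Proof.
rewrite mcoeff_msupp mcoeff_pihomog; case: (mdeg m =P 2%N) => [m2 mh|_]; last by rewrite eqxx.
by rewrite mcoeff_msupp.
Qed.

Let quad_homog e (h : {mpoly k[d]}) : h \is e.-homog for mf ->
  pihomog mdeg 2 h \is e.-homog for mf.
Proof. by move=> /dhomogP hh; apply/dhomogP => m /msupp_pihomog2[/hh]. Qed.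

Let quad_homog' e (h : {mpoly k[d]}) : h \is e.-homog for mf ->
  pihomog mdeg 2 h \is (2 * e - 2).-homog for mf'.
Proof.
move=> /dhomogP hh; apply/dhomogP => m /msupp_pihomog2[/hh em m2].
by rewrite -em -mf'E m2 addnK.
Qed.

Let zero_locus_stable (mu : measure d) (w : 'I_d -> nat) E :
  (forall i, mu U_(i)%MM = w i) ->
  (forall p, p \in E -> exists e, p \is e.-homog for mu) ->
  gm_stable w (zero_locus E : {ffun 'I_d -> k} -> Prop).
Proof.
move=> muU hE c u c0 Eu p pE; have [e hp] := hE p pE.
exact: (homog_zero_stable muU hp) c0 (Eu p pE).
Qed.

Let zero_locus_origin E : (forall p, p \in E -> p@_0%MM = 0) ->
  zero_locus E ([ffun=> 0] : {ffun 'I_d -> k}).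
Proof.
move=> hE p /hE p0; rewrite (meval_eq (v2 := fun=> 0)) ?meval_origin //.
by move=> i; rewrite ffunE.
Qed.

Let X_stable : gm_stable v X. Proof. exact: zero_locus_stable. Qed.

Let Q_stable : gm_stable v Q.
Proof.
apply: zero_locus_stable mfU _ => _ /mapP[h /hs_homog[e hh] ->].
by exists e; apply: quad_homog.
Qed.

Let Q_stable' : gm_stable v' Q.
Proof.
apply: (zero_locus_stable (mu := mf')) => // _ /mapP[h /hs_homog[e hh] ->].
by exists (2 * e - 2)%N; apply: quad_homog'.
Qed.

Let X_origin : X [ffun=> 0].
Proof. by apply: zero_locus_origin => h hX; rewrite hs_order ?mdeg0. Qed.

Let Q_origin : Q [ffun=> 0].
Proof.
apply: zero_locus_origin => _ /mapP[h _ ->]; apply/eqP; rewrite mcoeff_eq0.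
by apply/negP => /msupp_pihomog2[_]; rewrite mdeg0.
Qed.

Let proj_chain_lt (w : 'I_d -> nat) (Y : {ffun 'I_d -> k} -> Prop) r n c :
  (forall i, (0 < w i)%N) -> gm_stable w Y -> Y [ffun=> 0] -> alg_dependent r Y ->
  irreducible_chain (proj_closed_in w Y) n c -> (n < r)%N.
Proof.
move=> w_gt0 sY Y0 dep ch.
have [c' ch'] := affine_cone_chain w_gt0 sY Y0 ch.
exact: alg_dependent_chain dep ch'.
Qed.

(** Each equation of [Q] is its own top component, so [q] and [h] coincide here. *)
Let quad_dependent n (f : 'I_n -> {mpoly k[d]}) (delta : 'I_n -> nat) :
  (forall i, (0 < delta i)%N) -> (forall i, f i \is (delta i).-homog for mf) ->
  (forall u, Q u -> (forall i, (f i).@[u] = 0) -> u = [ffun=> 0]) ->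
  alg_dependent n.+1 Q.
Proof.
move=> d0 hf f0; pose q (j : 'I_(size qs)) := tnth (in_tuple qs) j.
have qQ u : (forall j, (q j).@[u] = 0) -> zero_locus qs [ffun i => u i].
  move=> qu p /(tnthP (in_tuple qs))[j ->]; rewrite -[RHS](qu j).
  by apply: meval_eq => i; rewrite ffunE.
have ex_e (j : 'I_(size qs)) : exists e, q j \is e.-homog for mf.
  have /mapP[h /hs_homog[e hh] eqh] := mem_tnth j (in_tuple qs).
  by exists e; rewrite /q eqh; apply: quad_homog.
have [e hq] := choice_fun ex_e.
have sQ : included Q (fun u => forall j, (q j).@[u] = 0).
  by move=> u Qu j; apply: Qu; exact: mem_tnth.
apply: alg_dependent_sub sQ _.
apply: (alg_dependent_zero_locus (mf := mf) (q := q) (e := e) (f := f) (delta := delta)) => //.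
- by move=> i; rewrite mfU.
- by move=> j; rewrite subrr mmeasure0.
move=> u /qQ Qu fu i; have /ffunP/(_ i) : [ffun i => u i] = [ffun=> 0] :> {ffun 'I_d -> k}.
  apply: f0 => // j; rewrite -[RHS](fu j).
  by apply: meval_eq => l; rewrite ffunE.
by rewrite !ffunE.
Qed.

Let quasi_dependent n (f : 'I_n -> {mpoly k[d]}) (delta : 'I_n -> nat) :
  (forall i, (0 < delta i)%N) -> (forall i, f i \is (delta i).-homog for mf') ->
  (forall u, Q u -> (forall i, (f i).@[u] = 0) -> u = [ffun=> 0]) ->
  alg_dependent n.+1 X.
Proof.
move=> d0 hf f0; pose h (j : 'I_(size hs)) := tnth (in_tuple hs) j.
have hX j : h j \in hs by apply: mem_tnth.
have qQ u : (forall j, (pihomog mdeg 2 (h j)).@[u] = 0) ->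
    zero_locus qs [ffun i => u i].
  move=> qu _ /mapP[p /(tnthP (in_tuple hs))[j ->] ->]; rewrite -[RHS](qu j).
  by apply: meval_eq => i; rewrite ffunE.
have [e hh] := choice_fun (fun j => hs_homog (hX j)).
have sX : included X (fun u => forall j, (h j).@[u] = 0) by move=> u Xu j; apply: Xu.
apply: alg_dependent_sub sX _.
apply: (alg_dependent_zero_locus (mf := mf') (q := fun j => pihomog mdeg 2 (h j))
  (e := fun j => (2 * e j - 2)%N) (f := f) (delta := delta)) => //.
- by move=> j; apply: quad_homog'.
(* A monomial of degree at least 3 in [h j] has [mf']-weight [2 * e j] minus its degree, less than
   the weight [2 * e j - 2] of the quadratic part. *)
- move=> j; apply/mmeasure_leP => m mp.
  have [m_ge3 em] : (2 < mdeg m)%N /\ mf m = e j.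
    have mh : m \in msupp (h j).
      by move/msuppB_le: mp; rewrite mem_cat => /orP[/msupp_pihomog2[]|].
    split; last exact: (dhomog_mf (hh j)).
    rewrite ltn_neqAle; apply/andP; split.
      apply: contraL mp => /eqP m2.
      by rewrite -mcoeff_eq0 mcoeffB mcoeff_pihomog /= -m2 eqxx subrr.
    rewrite leqNgt; apply/negP => /(hs_order (hX j)) hm0.
    by move: mh; rewrite mcoeff_msupp hm0 eqxx.
  have := mf'E m; rewrite em => <-.
  by rewrite ltn_subRL addnC ltn_add2l.
move=> u /qQ Qu fu i; have /ffunP/(_ i) : [ffun i => u i] = [ffun=> 0] :> {ffun 'I_d -> k}.
  apply: f0 => // j; rewrite -[RHS](fu j).
  by apply: meval_eq => l; rewrite ffunE.
by rewrite !ffunE.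
Qed.

Theorem quadratic_cone_dim : exists dM dPQ dQ : int,
  [/\ has_dim (proj_closed_in v X) dM, has_dim (proj_closed_in v Q) dPQ
    & has_dim (closed_in Q) dQ] /\ (dM <= dPQ)%R /\ (dM < dQ)%R.
Proof.
have Q_closed : zariski_closed Q by apply: zariski_closed_locus.
(* All sets of points being [alg_dependent d.+1], chains have bounded length and the three
   dimensions exist. *)
have [|nM [dimM [[cM chM] _]]] := @bounded_has_dim _ (proj_closed_in v X) d.+1.
  move=> m c /(proj_chain_lt v_gt0 X_stable X_origin (@alg_dependent_all k d X)).
  exact: ltnW.
have [|nP [dimP [[cP chP] maxP]]] := @bounded_has_dim _ (proj_closed_in v Q) d.+1.
  move=> m c /(proj_chain_lt v_gt0 Q_stable Q_origin (@alg_dependent_all k d Q)).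
  exact: ltnW.
have [|nQ [dimQ [_ maxQ]]] := @bounded_has_dim _ (closed_in Q) d.+1.
  by move=> m c /(alg_dependent_chain (@alg_dependent_all k d Q)).
exists (nM%:Z - 1), (nP%:Z - 1), (nQ%:Z - 1); split=> //.
have le_MP : (nM <= nP)%N.
  (* Algebraic dependence of [Q] does not refer to weights: it transports the chain bound from [v]
     to [v'], and the parameters found for [v'] then serve for [X]. *)
  have [f [e [e0 hf f0]]] := exists_parameters v_gt0 mfU Q_closed Q_stable maxP.
  have depQ := quad_dependent e0 hf f0.
  have maxP' m c : irreducible_chain (proj_closed_in v' Q) m c -> (m <= nP)%N.
    exact: proj_chain_lt v'_gt0 Q_stable' Q_origin depQ.
  have [f' [e' [e'0 hf' f'0]]] :=
    exists_parameters v'_gt0 (mf := mf') (fun=> erefl) Q_closed Q_stable' maxP'.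
  have depX := quasi_dependent e'0 hf' f'0.
  exact: proj_chain_lt v_gt0 X_stable X_origin depX chM.
have lt_PQ : (nP < nQ)%N.
  by have [c /maxQ] := affine_cone_chain v_gt0 Q_stable Q_origin chP.
by rewrite lerD2r ltrD2r lez_nat ltz_nat le_MP (leq_ltn_trans le_MP).
Qed.
End QuadraticApproximation.

(** * Elimination of the linear variables *)

Section LinearPart.
Variables (R : comNzRingType) (a b : nat).

Lemma mcoeffU_mulr0 (p q : {mpoly R[b]}) i : p@_0%MM = 0 ->
  (p * q)@_U_(i)%MM = p@_U_(i)%MM * q@_0%MM.
Proof.
move=> p0.
have dE (r : {mpoly R[b]}) : (r^`M(i))@_0%MM = r@_U_(i)%MM.
  by rewrite mcoeff_deriv add0m mnm0E mulr1n.
by rewrite -!dE mderivM mcoeffD !(rmorphM (mcoeff 0%MM)) /= p0 mul0r addr0.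
Qed.

(** The chain rule at the origin, which the substituted polynomials fix because they have no
    constant term. *)
Lemma mcoeffU_comp (p : {mpoly R[a]}) (th : a.-tuple {mpoly R[b]}) i :
  (forall l, (tnth th l)@_0%MM = 0) ->
  (p \mPo th)@_U_(i)%MM = \sum_l p@_U_(l)%MM * (tnth th l)@_U_(i)%MM.
Proof.
move=> th0; elim/mpolyind: p => [|c m p _ _ ih].
  by rewrite comp_mpoly0 mcoeff0 big1 // => l _; rewrite mcoeff0 mul0r.
rewrite comp_mpolyD comp_mpolyZ mcoeffD mcoeffZ ih.
under [RHS]eq_bigr do rewrite mcoeffD mcoeffZ mulrDl -mulrA.
rewrite big_split -mulr_sumr /=; congr (c * _ + _).
case: (posnP (mdeg m)) => [/eqP|].
  rewrite mdeg_eq0 => /eqP->; rewrite mpolyX0 comp_mpoly1 mcoeff1 mnm1_eq0 big1 //.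
  by move=> l _; rewrite mcoeff1 mnm1_eq0 mul0r.
rewrite lt0n mdegE sum_nat_eq0 => /forallPn[l0]; rewrite negb_imply /= -lt0n => l0m.
have -> : m = (U_(l0) + (m - U_(l0)))%MM.
  rewrite addmC submK //; apply/mnm_lepP => j; rewrite mnm1E.
  by case: eqP => // <-.
move: (m - _)%MM => m'; rewrite mpolyXD rmorphM /= comp_mpolyXU -tnth_nth.
rewrite mcoeffU_mulr0 // comp_mpolyX rmorph_prod /=.
have -> : \prod_l (tnth th l ^+ m' l)@_0%MM = (m' == 0%MM)%:R.
  under eq_bigr do rewrite rmorphXn /= th0.
  rewrite prodrXr -mdegE -mdeg_eq0.
  by case: (mdeg m') => [|e]; rewrite ?expr0 // exprS mul0r.
rewrite (bigD1 l0) //= -mpolyXD mcoeffX -{2}[U_(l0)%MM]addm0 eqm_add2l.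
rewrite mulrC big1 ?addr0 // => l ne; rewrite mcoeffX.
case: eqP => [eqU|]; last by rewrite mul0r.
have /eqP := congr1 (fun x : 'X_{1..a} => x l) eqU.
have /eqP := congr1 (fun x : 'X_{1..a} => x l0) eqU.
by rewrite /= !mnmDE !mnm1E eqxx (negPf ne).
Qed.

Lemma meval_pihomog1 (p : {mpoly R[a]}) u :
  (pihomog mdeg 1 p).@[u] = \sum_l p@_U_(l)%MM * u l.
Proof.
elim/mpolyind: p => [|c m p _ _ ih].
  by rewrite raddf0 meval0 big1 // => l _; rewrite mcoeff0 mul0r.
rewrite linearD linearZ /= mevalD mevalZ ih.
under [RHS]eq_bigr do rewrite mcoeffD mcoeffZ mulrDl -mulrA.
rewrite big_split -mulr_sumr /=; congr (c * _ + _); rewrite pihomogX /=.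
case: ifP => [|/negbT nm].
  rewrite mdeg_eq1 => /existsP[l0 /eqP->]; rewrite mevalXU (bigD1 l0) //=.
  rewrite mcoeffXU eqxx mul1r big1 ?addr0 // => l ne.
  by rewrite mcoeffXU eq_sym (negPf ne) mul0r.
rewrite meval0 big1 // => l _; rewrite mcoeffX; case: eqP => [eqm|]; last by rewrite mul0r.
by move: nm; rewrite eqm mdeg1.
Qed.

Lemma comp_mpoly_homog (mu : measure a) (nu : measure b) e (p : {mpoly R[a]})
    (th : a.-tuple {mpoly R[b]}) : p \is e.-homog for mu ->
  (forall l, tnth th l \is (mu U_(l)%MM).-homog for nu) ->
  p \mPo th \is e.-homog for nu.
Proof.
move=> /dhomogP hp hth; rewrite comp_mpolyE big_seq; apply: rpred_sum => m mp.
apply: dhomogZ; rewrite -(hp m mp) (mfE mu).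
apply: (big_rec2 (fun (q : {mpoly R[b]}) s => q \is s.-homog for nu)).
  exact: dhomog1.
move=> l s q _ hq; apply: dhomogM => //.
by rewrite mulnC; apply: dhomogMn.
Qed.
End LinearPart.

(** The zero ideal is prime, so a nonzero polynomial is nonzero at some point. *)
Lemma mpoly_eq0_meval (k : closedFieldType) n (p : {mpoly k[n]}) :
  (forall u, p.@[u] = 0) -> p = 0.
Proof.
move=> p0; apply: NNPP => pn0.
have [||u [_]] := @prime_has_point k n (fun q => q = 0) p; last by rewrite p0 eqxx.
  split=> [|/eqP|x y /eqP]; last by rewrite mulf_eq0 => /orP[]/eqP; [left | right].
    by split=> [|x y -> ->|x y ->]; rewrite ?addr0 ?mulr0.
  by rewrite oner_eq0.
by [].
Qed.

(** * Variables indexed by a list *)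

Section IndexedVariables.
Variables (T : eqType) (l : seq T).

Lemma wdegU (wt : T -> nat) i : wdeg wt l U_(i)%MM = wt (tnth (in_tuple l) i).
Proof.
rewrite /wdeg (bigD1 i) //= mnm1E eqxx muln1 big1 ?addn0 // => j ne.
by rewrite mnm1E eq_sym (negPf ne) muln0.
Qed.

Lemma extend0_tnth (V : nmodType) (u : 'I_(size l) -> V) i : uniq l ->
  extend0 u (tnth (in_tuple l) i) = u i.
Proof.
move=> Ul; rewrite /extend0 (tnth_nth (tnth (in_tuple l) i)) index_uniq //.
by rewrite valK.
Qed.

Lemma meval_mvar (R : comNzRingType) (u : 'I_(size l) -> R) t :
  (mvar R l t).@[u] = extend0 u t.
Proof.
by rewrite /mvar /extend0; case: insubP => [i _ _|_]; rewrite ?mevalXU ?meval0.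
Qed.

Lemma mvar_homog (R : comNzRingType) (wt : T -> nat) t :
  mvar R l t \is (wt t).-homog for (wdeg wt l).
Proof.
rewrite /mvar /extend0; case: insubP => [i lt eqi|_]; last exact: rpred0.
rewrite dhomogX /= wdegU (tnth_nth t) /= eqi nth_index //.
by rewrite -index_mem.
Qed.

Lemma mvar_coef0 (R : comNzRingType) t : (mvar R l t)@_0%MM = 0.
Proof.
rewrite /mvar /extend0; case: insubP => [i _ _|_]; last exact: mcoeff0.
by rewrite mcoeffX mnm1_eq0.
Qed.
End IndexedVariables.

(** * The equations after normalization and elimination *)

Section Instance.
Variables (k : closedFieldType) (H : pred nat) (g : nat).
Variables (L : nat -> seq (nat * nat)).
Variables (eps : didx -> nat -> didx -> int)
  (eta : didx -> nat -> didx -> {mpoly k[size (coefs H g L)]})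
  (Z : cidx -> 'X_{1..size (ngs H g)})
  (rho : cidx -> {mpoly k[size (coefs H g L)]}).
Hypothesis Hdec : decompositions eps eta Z rho.
Variables (N : nat -> seq cidx) (fs ps J : seq cidx).
Variables (lam phi : cidx -> {mpoly k[size fs]}).
Hypothesis Helim : elimination rho N ps J lam phi.

Lemma uniq_coefs : uniq (coefs H g L).
Proof.
apply: allpairs_uniq_dep; last by move=> [x a] [y b] _ _ [-> ->].
  apply: allpairs_uniq_dep; last by move=> [x a] [y b] _ _ [-> ->].
    exact/filter_uniq/iota_uniq.
  by move=> s _; apply: iota_uniq.
by move=> q _; apply/filter_uniq/iota_uniq.
Qed.

Lemma coefs_weight_gt0 t : t \in coefs H g L -> (0 < cwt t)%N.
Proof.
move=> /allpairsPdep[q [n [_ nq ->]]]; rewrite /cwt /= subn_gt0.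
by move: nq; rewrite mem_filter mem_iota => /andP[_ /andP[]].
Qed.

Let mem_fsps t : t \in fs ++ ps -> t \in coefs H g L.
Proof.
by case: Helim => /perm_mem-> _ _ _ _; rewrite mem_filter => /andP[].
Qed.

Let uniq_fsps : uniq (fs ++ ps).
Proof. by case: Helim => /perm_uniq-> _ _ _ _; rewrite filter_uniq ?uniq_coefs. Qed.

Lemma fweights_gt0 i : (0 < @fweights fs i)%N.
Proof. by apply/coefs_weight_gt0/mem_fsps; rewrite mem_cat mem_tnth. Qed.

Let ps_gt0 t : t \in ps -> (0 < cwt t)%N.
Proof. by move=> tp; apply/coefs_weight_gt0/mem_fsps; rewrite mem_cat tp orbT. Qed.

Let fs_notin_ps i : tnth (in_tuple fs) i \notin ps.
Proof.
move: uniq_fsps; rewrite cat_uniq => /and3P[_ /hasPn h _]; apply/negP => /h.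
by rewrite /= mem_tnth.
Qed.

Let rho_weight (j : cidx) := (j.1.1 + (2 * g - 2) - j.2)%N.

Let rho_weight_gt0 j : j \in rho_indices H g L -> (0 < rho_weight j)%N.
Proof.
move=> /allpairsPdep[q [n [_ nq ->]]]; rewrite /rho_weight /= subn_gt0.
by move: nq; rewrite mem_filter mem_iota => /andP[_ /andP[]].
Qed.

Let th t := if t \in ps then phi t else mvar k fs t.

Let hpolyE j : hpoly rho ps phi j = nrho rho (fs ++ ps) j \mPo
  [tuple th (tnth (in_tuple (fs ++ ps)) i) | i < size (fs ++ ps)].
Proof. by []. Qed.

Let th_homog t : th t \is (cwt t).-homog for (wdeg cwt fs).
Proof.
rewrite /th; case: ifP => [tp|_]; last exact: mvar_homog.
by case: Helim => _ _ _ _ [h _]; apply: h.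
Qed.

Let th_coef0 t : (th t)@_0%MM = 0.
Proof.
have := th_homog t; rewrite /th; case: ifP => [tp h|_ _]; last exact: mvar_coef0.
by apply: dhomog_nemf_coeff h _; rewrite mf0 eq_sym -lt0n ps_gt0.
Qed.

(** Normalization and elimination both replace a variable by a quasi-homogeneous polynomial of the
    same weight, 0 included. *)
Lemma hpoly_homog j : j \in rho_indices H g L ->
  hpoly rho ps phi j \is (rho_weight j).-homog for (wdeg cwt fs).
Proof.
move=> jr; rewrite hpolyE.
apply: (comp_mpoly_homog (mu := wdeg cwt (fs ++ ps))); last first.
  by move=> l; rewrite tnth_mktuple /= wdegU.
apply: (comp_mpoly_homog (mu := wdeg cwt (coefs H g L))).
  by case: Hdec => _ h _ _; apply: h.
by move=> l; rewrite tnth_mktuple /= wdegU; apply: mvar_homog.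
Qed.

(** The graph of [phi] solves the equations of [J], so the substituted polynomial vanishes at every
    point. *)
Lemma hpoly_eliminated j : j \in J -> hpoly rho ps phi j = 0.
Proof.
move=> jJ; apply: mpoly_eq0_meval => u; rewrite hpolyE comp_mpoly_meval.
case: Helim => _ _ _ _ [_ sol].
pose c t := (th t).@[u].
have cfs : c \o tnth (in_tuple fs) =1 u.
  move=> i; rewrite /c /th /= (negPf (fs_notin_ps i)) meval_mvar extend0_tnth //.
  by move: uniq_fsps; rewrite cat_uniq => /andP[].
have cps p : p \in ps -> c p = (phi p).@[c \o tnth (in_tuple fs)].
  by move=> pp; rewrite (meval_eq _ cfs) /c /th pp.
have := (sol c).2 cps (nrho rho (fs ++ ps) j) (map_f _ jJ).
by move=> <-; apply: meval_eq => i; rewrite tnth_mktuple.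
Qed.

(* The linear parts of [phi] solve the linear system of [J], hence all the
   linear equations. *)
Lemma hpoly_linear j i : j \in rho_indices H g L ->
  (hpoly rho ps phi j)@_U_(i)%MM = 0.
Proof.
case: Helim => _ [_ sol_all] [_ sJ _] solJ _.
(* The derivative at the origin, in the [i]-th direction, of the parametrization by [phi]. *)
pose c t := (th t)@_U_(i)%MM.
have lin j' : (hpoly rho ps phi j')@_U_(i)%MM =
    (pihomog mdeg 1 (nrho rho (fs ++ ps) j')).@[c \o tnth (in_tuple (fs ++ ps))].
  rewrite hpolyE mcoeffU_comp => [|l]; last by rewrite tnth_mktuple th_coef0.
  by rewrite meval_pihomog1; apply: eq_bigr => l _; rewrite tnth_mktuple.
have cps : forall p, p \in ps -> c p = (lam p).@[c \o tnth (in_tuple fs)].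
  apply/(solJ c) => _ /mapP[j' j'J ->]; rewrite -lin hpoly_eliminated //.
  exact: mcoeff0.
by move=> jr; rewrite lin; apply: ((sol_all c).2 cps); apply: map_f.
Qed.

Lemma hpoly_order j m : j \in rho_indices H g L -> (mdeg m < 2)%N ->
  (hpoly rho ps phi j)@_m = 0.
Proof.
move=> jr; rewrite ltnS leq_eqVlt ltnS leqn0 => /orP[|].
  by rewrite mdeg_eq1 => /existsP[i /eqP->]; apply: hpoly_linear.
rewrite mdeg_eq0 => /eqP->; apply: (dhomog_nemf_coeff (hpoly_homog jr)).
by rewrite mf0 eq_sym -lt0n rho_weight_gt0.
Qed.
End Instance.

Theorem theorem3p1
  (k : closedFieldType) (H : pred nat) (ell : seq nat) (g n1 : nat)
  (H_semigroup : numerical_semigroup H)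
  (H_gaps : gap_sequence H ell)
  (H_genus : size ell = g)
  (H_symmetric : last 0%N ell = (2 * g - 1)%N)
  (H_mult : multiplicity H n1)
  (n1_bounds : (3 < n1 < g)%N)
  (H_not45 : ~ (forall n, H n <-> exists a b, n = (4 * a + 5 * b)%N))
  (k_char : forall p, p \in [pchar k] -> forall m n, H m -> H n ->
     (m < n <= 2 * g - 2)%N -> ~~ (p %| n - m)%N)
  (L : nat -> seq (nat * nat))
  (HL : partition_listing H g L)
  (eps : didx -> nat -> didx -> int)
  (Heps : syzygies k H g L eps)
  (eta : didx -> nat -> didx -> {mpoly k[size (coefs H g L)]})
  (Z : cidx -> 'X_{1..size (ngs H g)})
  (rho : cidx -> {mpoly k[size (coefs H g L)]})
  (Hdec : decompositions eps eta Z rho)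
  (N : nat -> seq cidx)
  (HN : normalization k H g L N)
  (fs ps J : seq cidx)
  (lam phi : cidx -> {mpoly k[size fs]})
  (Helim : elimination rho N ps J lam phi) :
  exists dM dPQ dQ : int,
    [/\ has_dim (proj_closed_in (@fweights fs) (X_H rho ps J phi)) dM,
        has_dim (proj_closed_in (@fweights fs) (Q_H rho ps J phi)) dPQ
      & has_dim (closed_in (Q_H rho ps J phi)) dQ] /\
    dM <= dPQ /\ dM < dQ.
Proof.
have w_gt0 := fweights_gt0 Helim.
(* The weights [2 w - 1] are written with a predecessor; positivity of [w] makes it a true
   subtraction of 1. *)
apply: (quadratic_cone_dim (mf := wdeg cwt fs)
  (mf' := wdeg (fun t => (2 * cwt t).-1) fs)) => //.
- by move=> i; rewrite /= wdegU.
- move=> m; rewrite /= /wdeg mdegE -big_split big_distrr; apply: eq_bigr => i _ /=.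
  have := w_gt0 i; rewrite /fweights; case: (cwt _) => // c _.
  by rewrite mulnA -{2}[m i]mul1n -mulnDl addn1 mulnS.
- move=> h /mapP[j]; rewrite mem_filter => /andP[_ jr] ->.
  by exists (j.1.1 + (2 * g - 2) - j.2)%N; exact: (hpoly_homog Hdec Helim jr).
move=> h /mapP[j]; rewrite mem_filter => /andP[_ jr] -> m.
exact: (hpoly_order Hdec Helim jr).
Qed.
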